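(* Let $X$ be a complex Banach space and let $T\in B(X)$ with $\sigma(T)\subset\overline{\mathbb{D}}$ and $\sigma(T)\cap\mathbb{T}\subset\{1\}$. The following are equivalent (where in each of (ii) and (iii) the version with ''some'' and the version with ''all'' are both equivalent to (i)): (i) $T$ is a Ritt operator; (ii) for some (or all) $m\in\mathbb{N}$ and $\alpha,\beta>0$ with $\alpha+\beta=m$, there is a constant $C>0$ such that $$\|R(\lambda,T)^m\|\le\frac{C}{|\lambda-1|^{\alpha}(|\lambda|-1)^{\beta}},\qquad 1<|\lambda|<2;$$ (iii) $T$ is power-bounded and, for some (or all) $k\in\mathbb{N}$, $\|T^n(I-T)^k\|=O(n^{-k})$.
   Context: $\mathbb{N}=\{1,2,\dots\}$; $\mathbb{D}$ is the open unit disk and $\mathbb{T}$ its boundary; $R(\lambda,T)=(\lambda I-T)^{-1}$. $T$ is a Ritt operator if $\sigma(T)\subset\overline{\mathbb{D}}$ and there is $C>0$ with $\|R(\lambda,T)\|\le\frac{C}{|\lambda-1|}$ for all $1<|\lambda|<2$. $T$ is power-bounded if $\sup_{n\ge0}\|T^n\|<\infty$. For nonnegative sequences, $a_n=O(b_n)$ means there is $C>0$ with $a_n\le C b_n$ for all $n\ge1$. *)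

(* Defs.v *)
From HB Require Import structures.
From mathcomp Require Import all_boot all_order all_algebra.
From mathcomp Require Import complex.
From mathcomp Require Import all_classical all_reals all_analysis.
Set Implicit Arguments.
Unset Strict Implicit.
Unset Printing Implicit Defensive.
Import Order.TTheory GRing.Theory Num.Theory.
Import numFieldNormedType.Exports.
Local Open Scope classical_set_scope.
Local Open Scope ring_scope.
Local Open Scope complex_scope.

(* [bop X] is the algebra B(X) of bounded linear operators on [X]. It is a
   [pzRingType] and an [lmodType K], but not an [algType K]: the latter requires
   a nontrivial ring, which fails when [X] is the zero space. The algebra laws
   are [bop_scaleAl] and [bop_scaleAr]. *)
Section BoundedOperators.
Variables (K : numFieldType) (X : normedModType K).

Definition bounded_linear (f : X -> X) : Prop :=
  linear f /\ exists M : K, forall x, `|f x| <= M * `|x|.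

Definition is_bop : {pred X -> X} := fun f => `[< bounded_linear f >].

Record bop := Bop { bop_fun :> X -> X; _ : bop_fun \in is_bop }.

HB.instance Definition _ := [isSub for bop_fun].
HB.instance Definition _ := [Choice of bop by <:].

Lemma bopP (S : bop) : bounded_linear S.
Proof. by case: S => f /= /asboolP. Qed.

Lemma bop_ext (S T : bop) : S =1 T -> S = T.
Proof. by move=> ST; apply/val_inj/funext. Qed.

Lemma bounded_linear_nneg (f : X -> X) : bounded_linear f ->
  exists2 M : K, 0 <= M & forall x, `|f x| <= M * `|x|.
Proof.
move=> [_ [M fM]]; have [M0|M0] := boolP (0 <= M); first by exists M.
exists 0 => // x; have [->|x0] := eqVneq x 0.
  by have := fM 0; rewrite !normr0 !mulr0.
have xp : 0 < `|x| by rewrite normr_gt0.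
by case/negP: M0; rewrite -(pmulr_lge0 _ xp) (le_trans _ (fM x)).
Qed.

Lemma is_bop_submod : submod_closed is_bop.
Proof.
split=> [|a f g /asboolP bf /asboolP bg]; apply/asboolP; split.
- by move=> a u v; rewrite [RHS](_ : _ = a *: 0 + 0)// scaler0 addr0.
- by exists 0 => x; rewrite mul0r normr0.
- move=> b u v; rewrite !fctE bf.1 bg.1 !scalerDr !scalerA (mulrC a b).
  by rewrite addrACA.
- have [M M0 fM] := bounded_linear_nneg bf.
  have [N N0 gN] := bounded_linear_nneg bg.
  exists (`|a| * M + N) => x; rewrite !fctE mulrDl -mulrA.
  by apply: (le_trans (ler_normD _ _)); rewrite lerD// normrZ ler_wpM2l.
Qed.

HB.instance Definition _ :=
  GRing.isSubmodClosed.Build K (X -> X) is_bop is_bop_submod.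
HB.instance Definition _ := [SubChoice_isSubLmodule of bop by <:].

Lemma is_bop_id : (id : X -> X) \in is_bop.
Proof. by apply/asboolP; split=> //; exists 1 => x; rewrite mul1r. Qed.

Lemma is_bop_comp (S T : bop) : S \o T \in is_bop.
Proof.
apply/asboolP; split=> [a u v /=|]; first by rewrite (bopP T).1 (bopP S).1.
have [M M0 SM] := bounded_linear_nneg (bopP S).
have [N N0 TN] := bounded_linear_nneg (bopP T).
exists (M * N) => x /=; apply: (le_trans (SM _)).
by rewrite -mulrA ler_wpM2l.
Qed.

Definition bop_one : bop := Bop is_bop_id.
Definition bop_mul (S T : bop) : bop := Bop (is_bop_comp S T).

Lemma bop_mulA : associative bop_mul.
Proof. by move=> S T U; apply: bop_ext. Qed.
Lemma bop_mul1 : left_id bop_one bop_mul.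
Proof. by move=> S; apply: bop_ext. Qed.
Lemma bop_mulr1 : right_id bop_one bop_mul.
Proof. by move=> S; apply: bop_ext. Qed.
Lemma bop_mulDl : left_distributive bop_mul +%R.
Proof. by move=> S T U; apply: bop_ext. Qed.
Lemma bop_mulDr : right_distributive bop_mul +%R.
Proof.
move=> S T U; apply: bop_ext => x.
have /= := (bopP S).1 1 (T x) (U x); rewrite !scale1r => H.
exact: H.
Qed.

HB.instance Definition _ := GRing.Zmodule_isPzRing.Build bop
  bop_mulA bop_mul1 bop_mulr1 bop_mulDl bop_mulDr.

Lemma bop_scaleAl (a : K) (S T : bop) : a *: (S * T) = (a *: S) * T.
Proof. by apply: bop_ext. Qed.

Lemma bop_scaleAr (a : K) (S T : bop) : a *: (S * T) = S * (a *: T).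
Proof.
apply: bop_ext => x; have SL := (bopP S).1.
have S0 : S 0 = 0.
  by have := SL (-1) 0 0; rewrite scaler0 addr0 scaleN1r addNr.
by have := SL a (T x) 0; rewrite !addr0 S0 addr0 => /esym.
Qed.

End BoundedOperators.
Arguments is_bop {K X}.

Section RittOperators.
Variable R : realType.

(* Norms over [R[i]] take values in [R[i]]; [rnorm] is the same norm read in
   [R], and applies both to complex numbers and to vectors. *)
Definition rnorm (V : normedZmodType R[i]) (x : V) : R := complex.Re `|x|.

Lemma rnormE (V : normedZmodType R[i]) (x : V) : `|x| = (rnorm x)%:C.
Proof. by rewrite /rnorm RRe_real// ger0_real. Qed.

Definition closed_unit_disk : set R[i] := [set z | rnorm z <= 1].
Definition unit_circle : set R[i] := [set z | rnorm z = 1].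

Variable X : normedModType R[i].
Implicit Types S T : bop X.

Definition opnorm T : R := sup [set rnorm (T x) | x in [set x | rnorm x <= 1]].

Lemma opnorm_has_sup T :
  has_sup [set rnorm (T x) | x in [set x | rnorm x <= 1]].
Proof.
have rleE (V W : normedZmodType R[i]) (x : V) (y : W) :
  (rnorm x <= rnorm y) = (`|x| <= `|y|) by rewrite !rnormE lecR.
split; first by exists (rnorm (T 0)), 0 => //=; rewrite /rnorm normr0.
have [M M0 TM] := bounded_linear_nneg (bopP T).
exists (rnorm M) => _ [x /= x1 <-]; rewrite rleE (ger0_norm M0).
by rewrite (le_trans (TM x))// ler_piMr// rnormE -[1]/(1%:C) lecR.
Qed.

Definition is_inverse S T : Prop := S * T = 1 /\ T * S = 1.

Definition spectrum T : set R[i] :=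
  [set l : R[i] | ~ exists S, is_inverse S (l *: (1 : bop X) - T)].

(* R(l, T); the value is a junk 0 when [l] is in the spectrum. *)
Definition resolvent (l : R[i]) T : bop X :=
  xget 0 [set S | is_inverse S (l *: (1 : bop X) - T)].

Definition ritt T : Prop :=
  spectrum T `<=` closed_unit_disk /\
  exists C : R, 0 < C /\ forall l : R[i], 1 < rnorm l < 2 ->
    opnorm (resolvent l T) <= C / rnorm (l - 1).

Definition power_bounded T : Prop :=
  has_ubound [set opnorm (T ^+ n) | n in [set: nat]].

Definition resolvent_power_bound T (m : nat) (a b : R) : Prop :=
  exists C : R, 0 < C /\ forall l : R[i], 1 < rnorm l < 2 ->
    opnorm (resolvent l T ^+ m) <=
      C / (rnorm (l - 1) `^ a * (rnorm l - 1) `^ b).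

Definition seq_bigO (u v : nat -> R) : Prop :=
  exists C : R, 0 < C /\ forall n : nat, (1 <= n)%N -> u n <= C * v n.

End RittOperators.

(* Main.v *)
Require Import Defs.
From HB Require Import structures.
From mathcomp Require Import all_boot all_order all_algebra.
From mathcomp Require Import complex.
From mathcomp Require Import all_classical all_reals all_analysis.
From mathcomp Require Import cyclic separable cyclotomic.
From mathcomp Require Import ring lra.
Set Implicit Arguments.
Unset Strict Implicit.
Unset Printing Implicit Defensive.
Import Order.TTheory GRing.Theory Num.Theory.
Import numFieldNormedType.Exports.
Local Open Scope classical_set_scope.
Local Open Scope ring_scope.
Local Open Scope complex_scope.

(** Put g(z) = (1 - z T)^-1, so that R(l, T) = g(1/l)/l. Contour integrals are
    replaced by means over the N-th roots of unity as N tends to infinity, and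
    the integral of |1 - z|^-2 over |z| = s by the mean of the Poisson kernel.
    Extracting the n-th coefficient of (1 - T)^k g(z)^(m+1) on the circle
    |z| = (n+1)/(n+2) turns a bound F/(|1 - z|^2 (1 - |z|)^b) into
    n^m ||T^n (1 - T)^k|| = O(n^(b+1)).

    (i) => (iii): apply this to (1 - T)^k g^(k+2), where (1 - T) g is bounded.
    (iii) => (ii): summing the power series of (1 - T)^k g^(k+1) bounds it by
    C/(1 - |z|), and (1 - T) g is essentially 1 - (1 - z) g, so that
    g^(k+1) = O(1/(|1 - z| (1 - |z|)^k)).
    (ii) => (i): a power of the bound has exponent at least 2 on |l - 1|, whence
    T is power-bounded and R(l, T) = O(1/(|l| - 1)). This is already the Ritt
    bound in a nontangential region; an algebraic perturbation argument for
    R(mu, T)^N carries it from mu to the points l radially below mu. *)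

(** * Real-valued norms over the complex field *)

Section Rnorm.
Context {R : realType}.

Lemma rnorm_ge0 (V : normedZmodType R[i]) (x : V) : 0 <= rnorm x.
Proof. by rewrite -(@lecR R) -rnormE normr_ge0. Qed.

Lemma ler_rnormD (V : normedZmodType R[i]) (x y : V) :
  rnorm (x + y) <= rnorm x + rnorm y.
Proof. by rewrite -(@lecR R) rmorphD /= -!rnormE ler_normD. Qed.

Lemma rnorm0 (V : normedZmodType R[i]) : rnorm (0 : V) = 0.
Proof. by rewrite /rnorm normr0. Qed.

Lemma rnormN (V : normedZmodType R[i]) (x : V) : rnorm (- x) = rnorm x.
Proof. by rewrite /rnorm normrN. Qed.

Lemma rnorm_distC (V : normedZmodType R[i]) (x y : V) :
  rnorm (x - y) = rnorm (y - x).
Proof. by rewrite -opprB rnormN. Qed.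

Lemma rnorm_eq0 (V : normedZmodType R[i]) (x : V) : (rnorm x == 0) = (x == 0).
Proof. by rewrite -(normr_eq0 x) rnormE -(inj_eq (@complexI R)). Qed.

Lemma rnormM (x y : R[i]) : rnorm (x * y) = rnorm x * rnorm y.
Proof. by apply: (@complexI R); rewrite rmorphM /= -!rnormE normrM. Qed.

Lemma rnorm1 : rnorm (1 : R[i]) = 1.
Proof. by rewrite /rnorm normr1. Qed.

Lemma rnormX (x : R[i]) n : rnorm (x ^+ n) = rnorm x ^+ n.
Proof. by elim: n => [|n IH]; rewrite ?expr0 ?rnorm1// !exprS rnormM IH. Qed.

Lemma rnormV (x : R[i]) : rnorm x^-1 = (rnorm x)^-1.
Proof. by apply: (@complexI R); rewrite fmorphV -!rnormE normfV. Qed.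

Lemma rnorm_real (r : R) : 0 <= r -> rnorm (r%:C) = r.
Proof. by move=> r0; rewrite /rnorm ger0_norm// lecR. Qed.

Lemma rnormZ (X : normedModType R[i]) (a : R[i]) (x : X) :
  rnorm (a *: x) = rnorm a * rnorm x.
Proof. by apply: (@complexI R); rewrite rmorphM /= -!rnormE normrZ. Qed.

Lemma ler_rnormB (V : normedZmodType R[i]) (x y : V) :
  rnorm x - rnorm y <= rnorm (x - y).
Proof. by rewrite lerBlDr -[x in leLHS](subrK y) ler_rnormD. Qed.

End Rnorm.

(** * The operator norm on B(X) *)

Section Opnorm.
Context {R : realType} {X : normedModType R[i]}.
Implicit Types (S T : bop X).

Lemma opnorm_ubound T (x : X) : rnorm x <= 1 -> rnorm (T x) <= opnorm T.
Proof.
move=> x1; have [_ ub] := opnorm_has_sup T.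
by apply: ub_le_sup => //; exists x.
Qed.

Lemma opnorm_ge0 T : 0 <= opnorm T.
Proof.
by apply: (le_trans (rnorm_ge0 (T 0))); rewrite opnorm_ubound// rnorm0.
Qed.

Lemma opnorm_le T (M : R) :
  (forall x, rnorm x <= 1 -> rnorm (T x) <= M) -> opnorm T <= M.
Proof.
move=> H; apply: ge_sup; first by have [] := opnorm_has_sup T.
by move=> _ [x x1 <-]; exact: H.
Qed.

Lemma bopZ T a x : T (a *: x) = a *: T x.
Proof.
have T0 : T 0 = 0 by have := (bopP T).1 (-1) 0 0;
  rewrite scaler0 addr0 scaleN1r addNr.
by have := (bopP T).1 a x 0; rewrite !addr0 T0 addr0.
Qed.

Lemma opnormP T x : rnorm (T x) <= opnorm T * rnorm x.
Proof.
have [->|x0] := eqVneq x 0.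
  by rewrite -(scale0r (0 : X)) bopZ !scale0r !rnorm0 mulr0.
have xn0 : 0 < rnorm x by rewrite lt_neqAle rnorm_ge0 eq_sym rnorm_eq0 x0.
have xV : rnorm ((rnorm x)^-1)%:C = (rnorm x)^-1.
  by rewrite rnorm_real ?invr_ge0 ?rnorm_ge0.
rewrite -ler_pdivrMr//.
have /(opnorm_ubound T) : rnorm (((rnorm x)^-1)%:C *: x) <= 1.
  by rewrite rnormZ xV mulVf ?gt_eqF.
by rewrite bopZ rnormZ xV mulrC.
Qed.

Lemma opnorm0 : opnorm (0 : bop X) = 0.
Proof.
by apply/eqP; rewrite eq_le opnorm_ge0 andbT opnorm_le// => x _; rewrite rnorm0.
Qed.

Lemma opnorm1_le : opnorm (1 : bop X) <= 1.
Proof. exact: opnorm_le. Qed.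

Lemma opnormD S T : opnorm (S + T) <= opnorm S + opnorm T.
Proof.
apply: opnorm_le => x x1; apply: (le_trans (ler_rnormD _ _)).
by rewrite lerD// opnorm_ubound.
Qed.

Lemma opnormZ_le a T : opnorm (a *: T) <= rnorm a * opnorm T.
Proof.
apply: opnorm_le => x x1; rewrite [X in rnorm X](_ : _ = a *: T x)//.
by rewrite rnormZ ler_wpM2l ?rnorm_ge0// opnorm_ubound.
Qed.

Lemma opnormZ a T : opnorm (a *: T) = rnorm a * opnorm T.
Proof.
apply/eqP; rewrite eq_le opnormZ_le/=.
have [->|a0] := eqVneq a 0; first by rewrite rnorm0 mul0r opnorm_ge0.
have an0 : 0 < rnorm a by rewrite lt_neqAle rnorm_ge0 eq_sym rnorm_eq0 a0.
rewrite -ler_pdivlMl// -rnormV (le_trans _ (opnormZ_le _ _))//.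
by rewrite scalerA mulVf// scale1r.
Qed.

Lemma opnormN T : opnorm (- T) = opnorm T.
Proof. by rewrite -scaleN1r opnormZ rnormN rnorm1 mul1r. Qed.

Lemma opnormM S T : opnorm (S * T) <= opnorm S * opnorm T.
Proof.
apply: opnorm_le => x x1; apply: (le_trans (opnormP S (T x))).
by rewrite ler_wpM2l ?opnorm_ge0// opnorm_ubound.
Qed.

Lemma opnormX T n : opnorm (T ^+ n) <= opnorm T ^+ n.
Proof.
elim: n => [|n IH]; first by rewrite !expr0 opnorm1_le.
by rewrite !exprS (le_trans (opnormM _ _))// ler_wpM2l ?opnorm_ge0.
Qed.

Lemma opnorm_sum I (r : seq I) (P : pred I) (F : I -> bop X) :
  opnorm (\sum_(i <- r | P i) F i) <= \sum_(i <- r | P i) opnorm (F i).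
Proof.
elim/big_rec2: _ => [|i x y _ H]; first by rewrite opnorm0.
by rewrite (le_trans (opnormD _ _))// lerD2l.
Qed.

Lemma opnormM_le S T (a b : R) : opnorm S <= a -> opnorm T <= b ->
  opnorm (S * T) <= a * b.
Proof.
by move=> Sa Tb; rewrite (le_trans (opnormM _ _))// ler_pM ?opnorm_ge0.
Qed.

Lemma opnormX_le T (a : R) n : opnorm T <= a -> opnorm (T ^+ n) <= a ^+ n.
Proof.
by move=> Ta; rewrite (le_trans (opnormX _ _))// lerXn2r ?nnegrE ?opnorm_ge0//
  (le_trans _ Ta) ?opnorm_ge0.
Qed.

Lemma opnormB S T : opnorm (S - T) <= opnorm S + opnorm T.
Proof. by rewrite (le_trans (opnormD _ _))// opnormN. Qed.

Lemma bop_exprZn a T n : (a *: T) ^+ n = a ^+ n *: T ^+ n.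
Proof.
elim: n => [|n IH]; first by rewrite !expr0 scale1r.
by rewrite !exprS IH -bop_scaleAl -bop_scaleAr scalerA.
Qed.

Lemma bop_scaler_comm a S T : GRing.comm S T -> GRing.comm S (a *: T).
Proof. by move=> ST; rewrite /GRing.comm -bop_scaleAr -bop_scaleAl ST. Qed.

End Opnorm.

(** * Inverses, and the reciprocal resolvent g(z) = (1 - zT)^-1 on the open disc *)

Section Inverses.
Context {R : realType} {X : normedModType R[i]}.
Implicit Types (S T U V : bop X).

Lemma is_inverse_comm S U V : is_inverse S U -> GRing.comm U V -> GRing.comm S V.
Proof.
move=> [SU US] UV; rewrite /GRing.comm -[LHS]mulr1 -US -!mulrA (mulrA V) -UV.
by rewrite -mulrA mulrA SU mul1r.
Qed.

End Inverses.

Section ReciprocalResolvent.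
Context {R : realType} {X : normedModType R[i]} {T : bop X} {g : R[i] -> bop X}.
Hypothesis gP : forall z, rnorm z < 1 -> is_inverse (g z) (1 - z *: T).
Implicit Types (z w : R[i]).

Lemma grecip_comm z V : rnorm z < 1 -> GRing.comm T V -> GRing.comm (g z) V.
Proof.
move=> z1 TV; apply: (is_inverse_comm (gP z1)); apply: commr_sym.
apply: commrB; first exact: commr1.
exact/bop_scaler_comm/commr_sym.
Qed.

Lemma grecip_commT z : rnorm z < 1 -> GRing.comm (g z) T.
Proof. by move=> z1; exact: grecip_comm. Qed.

Lemma grecipB z w : rnorm z < 1 -> rnorm w < 1 ->
  g z - g w = (z - w) *: (g w * T * g z).
Proof.
move=> z1 w1; have [_ zr] := gP z1; have [wl _] := gP w1.
have -> : g z - g w = g w * (1 - w *: T) * g z - g w * ((1 - z *: T) * g z).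
  by rewrite wl zr mul1r mulr1.
rewrite -mulrA -mulrBr -mulrBl mulrA.
have -> : 1 - w *: T - (1 - z *: T) = (z - w) *: T.
  by rewrite opprB addrC addrA subrK scalerBl.
by rewrite -bop_scaleAr -bop_scaleAl.
Qed.

(** By the resolvent identity, [g z - g w] has norm at most half that of [g z] when z is close to w;
    this half is absorbed on the left. *)
Lemma grecip_near w : rnorm w < 1 -> exists2 e : R, 0 < e &
  forall z, rnorm z < 1 -> rnorm (z - w) < e -> opnorm (g z) <= 2 * opnorm (g w).
Proof.
move=> w1; set G := opnorm (g w); set t := opnorm T.
have G0 : 0 <= G by exact: opnorm_ge0.
have t0 : 0 <= t by exact: opnorm_ge0.
have D0 : 0 < 2 * (G * t + 1) by rewrite mulr_gt0// ltr_wpDl// mulr_ge0.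
exists (2 * (G * t + 1))^-1 => [|z z1 zw]; first by rewrite invr_gt0.
have : opnorm (g z) <= G + 2^-1 * opnorm (g z).
  rewrite -[in leLHS](subrK (g w) (g z)) addrC (le_trans (opnormD _ _))//.
  rewrite lerD2l grecipB// opnormZ.
  have K : opnorm (g w * T * g z) <= G * t * opnorm (g z).
    by apply: opnormM_le => //; apply: opnormM_le.
  apply: (@le_trans _ _ ((2 * (G * t + 1))^-1 * (G * t * opnorm (g z)))).
    by rewrite ler_pM ?rnorm_ge0 ?opnorm_ge0// ltW.
  rewrite mulrA ler_wpM2r ?opnorm_ge0// invfM -mulrA ler_piMr//.
  by rewrite mulrC ler_pdivrMr ?mul1r ?lerDl// ltr_wpDl// mulr_ge0.
by move: (opnorm_ge0 (g z)); lra.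
Qed.

Lemma rnorm_Complex_le (a b : R) : rnorm (a +i* b) <= `|a| + `|b|.
Proof.
rewrite [a +i* b]complexE (le_trans (ler_rnormD _ _))// rnormM.
have -> : rnorm ('i : R[i]) = 1 by rewrite /rnorm normCi.
rewrite mul1r.
have H (r : R) : rnorm (r%:C) = `|r|.
  have [r0|r0] := leP 0 r; first by rewrite rnorm_real ?ger0_norm.
  by rewrite -rnormN -rmorphN rnorm_real ?oppr_ge0 ?ltW// ltr0_norm.
by rewrite !H.
Qed.

(** Compactness of the square [-1,1]^2, which contains the disc, makes the local bounds of
    [grecip_near] uniform. *)
Lemma grecip_bounded (rho : R) : rho < 1 -> exists2 G : R, 1 <= G &
  forall z, rnorm z <= rho -> opnorm (g z) <= G.
Proof.
move=> rho1; pose c (p : R * R) : R[i] := p.1 +i* p.2.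
have K : compact (`[(-1 : R), 1]%classic `*` `[(-1 : R), 1]%classic).
  by apply: compact_setX; exact: segment_compact.
have /compact_near_coveringP := K.
(* The bound M is the parameter of the near-covering property: each point needs a neighbourhood on
   which every large M works. *)
move=> /(_ _ (pinfty_nbhs R)
  (fun M p => rnorm (c p) <= rho -> opnorm (g (c p)) <= M) _).
have cB p q e : ball p e q -> rnorm (c q - c p) < e + e.
  move=> [/= pq1 pq2]; rewrite /c /= (le_lt_trans (rnorm_Complex_le _ _))//.
  by rewrite ltrD// distrC.
case=> [p _|M [_ HM]].
  have [pc|pc] := ltP (rnorm (c p)) 1.
    have [e e0 He] := grecip_near pc.
    exists (ball p (e / 2), [set M : R | 2 * opnorm (g (c p)) < M]) => /=.
      split; first by apply: nbhsx_ballx; rewrite divr_gt0.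
      by apply: nbhs_pinfty_gt; rewrite num_real.
    move=> [q M] /= [pq pM] qr; apply: (le_trans _ (ltW pM)); apply: He.
      exact: le_lt_trans qr rho1.
    by have := cB _ _ _ pq; rewrite -splitr.
  (* Here |c p| >= 1, and this ball misses the disc of radius rho. *)
  exists (ball p ((1 - rho) / 2), setT) => /=.
    by split; [apply: nbhsx_ballx; rewrite divr_gt0 ?subr_gt0 | exact: filterT].
  move=> [q M] /= [pq _] qr; have := cB _ _ _ pq; rewrite -splitr.
  have := ler_rnormB (c p) (c q); rewrite rnorm_distC => H1 H2.
  by move: (le_lt_trans H1 H2); lra.
exists (Num.max 1 (M + 1)) => [|z zr]; first by rewrite le_max lexx.
have := HM (M + 1); rewrite ltrDl ltr01 => /(_ isT).
case: z zr => a b zr /(_ (a, b)) => H.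
rewrite le_max H ?orbT//=; rewrite !in_itv /=.
have ab : `|a| <= 1 /\ `|b| <= 1.
  have z1 := ltW (le_lt_trans zr rho1); split;
    rewrite (le_trans _ z1)// -(@lecR R) -rnormE.
    exact: (normc_ge_Re (a +i* b)).
  by have := normc_ge_Re ('i * (a +i* b));
    rewrite normrM normCi mul1r /= !(mul0r, mul1r) sub0r normrN.
by case: ab; rewrite !ler_norml.
Qed.

End ReciprocalResolvent.

(** * Roots of unity and means over them *)

Section RootsOfUnity.
Context {R : realType}.

Lemma prim_root_exists n : (0 < n)%N -> exists w : R[i], n.-primitive_root w.
Proof.
move=> n_gt0; have [r] := closed_field_poly_normal ('X^n - 1 : {poly R[i]}).
rewrite (monicP _) ?monicXnsubC// scale1r => Dp.
have rn1 : all n.-unity_root r by apply/allP=> z; rewrite -root_prod_XsubC -Dp.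
have sz_r : (n < (size r).+1)%N by rewrite -(size_prod_XsubC r id) -Dp size_XnsubC.
have [|z _ zP] := hasP (has_prim_root n_gt0 rn1 _ sz_r); last by exists z.
by rewrite -separable_prod_XsubC -Dp separable_Xn_sub_1// pnatr_eq0 -lt0n.
Qed.

Lemma prim_root_rnorm n (w : R[i]) : n.-primitive_root w -> rnorm w = 1.
Proof.
move=> wP; apply/eqP; rewrite -(@pexpr_eq1 _ _ n) ?rnorm_ge0 ?(prim_order_gt0 wP)//.
by rewrite -rnormX (prim_expr_order wP) rnorm1.
Qed.

(** Orthogonality: if n does not divide k, then w^k is not 1 and the geometric sum telescopes to
    0. *)
Lemma sum_prim_root n (w : R[i]) k : n.-primitive_root w ->
  \sum_(j < n) (w ^+ j) ^+ k = if (n %| k)%N then n%:R else 0.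
Proof.
move=> wP; rewrite (eq_bigr (fun j : 'I_n => (w ^+ k) ^+ j)); last first.
  by move=> j _; rewrite -!exprM mulnC.
case: ifPn => [/dvdnP[m ->]|nk].
  rewrite mulnC exprM (prim_expr_order wP) expr1n.
  by under eq_bigr do rewrite expr1n; rewrite sumr_const card_ord.
have wk : w ^+ k - 1 != 0.
  by rewrite subr_eq0 -(expr0 w) (eq_prim_root_expr wP) /eqn mod0n.
apply: (mulfI wk); rewrite -subrX1 mulr0 -exprM mulnC exprM (prim_expr_order wP).
by rewrite expr1n subrr.
Qed.

Lemma expr_small (q e : R) : 0 <= q < 1 -> 0 < e ->
  exists N, forall n, (N <= n)%N -> q ^+ n <= e.
Proof.
move=> /andP[q0 q1] e0; have : `|q| < 1 by rewrite ger0_norm.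
move=> /cvg_expr/cvgrPdist_le/(_ e e0)[N _ HN].
by exists N => n Nn; have := HN n Nn; rewrite sub0r normrN ger0_norm ?exprn_ge0.
Qed.

Lemma opnorm_avg (X : normedModType R[i]) n (F : 'I_n -> bop X) :
  opnorm ((n%:R^-1 : R[i]) *: \sum_j F j) <= n%:R^-1 * \sum_j opnorm (F j).
Proof.
rewrite opnormZ rnormV -(rmorph_nat (@real_complex R)) rnorm_real ?ler0n//.
by rewrite ler_wpM2l ?invr_ge0 ?ler0n ?opnorm_sum.
Qed.

Lemma opnorm_avg_le (X : normedModType R[i]) n (F : 'I_n -> bop X) (c : R) :
  0 <= c -> (forall j, opnorm (F j) <= c) ->
  opnorm ((n%:R^-1 : R[i]) *: \sum_j F j) <= c.
Proof.
move=> c0 Fc; rewrite (le_trans (opnorm_avg _))//.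
apply: (@le_trans _ _ (n%:R^-1 * (c *+ n))).
  rewrite ler_wpM2l ?invr_ge0 ?ler0n// (le_trans (ler_sum _ (fun j _ => Fc j)))//.
  by rewrite sumr_const card_ord.
case: n {F Fc} => [|n]; first by rewrite invr0 mul0r.
by rewrite -[c *+ _]mulr_natr mulrCA mulVf ?mulr1// pnatr_eq0.
Qed.

End RootsOfUnity.

(** * Decay of s^n ||T^n|| for s < 1, in the role of the spectral radius formula *)

Section PowerDecay.
Context {R : realType} {X : normedModType R[i]} {T : bop X} {g : R[i] -> bop X}.
Hypothesis gP : forall z, rnorm z < 1 -> is_inverse (g z) (1 - z *: T).
Implicit Types (z w : R[i]).

Lemma onem_expr_grecip z n : rnorm z < 1 ->
  (1 - z ^+ n *: T ^+ n) * g z = \sum_(k < n) z ^+ k *: T ^+ k.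
Proof.
move=> z1; rewrite -bop_exprZn -opprB subrX1 -mulNr opprB.
under [RHS]eq_bigr do rewrite -bop_exprZn.
set S := \sum_(i < n) _; have -> : (1 - z *: T) * S = S * (1 - z *: T).
  apply: commr_sym; apply: commrB; first exact: commr1.
  apply: commr_sym; apply: commr_sum => i _; exact: commrX.
by rewrite -mulrA (gP z1).2 mulr1.
Qed.

(* The mean of (1 - z T)^-1 over the N-th roots [z] of [s ^+ N] is the inverse
   of 1 - (s T)^N: only the terms of the geometric series whose exponent is a
   multiple of [N] survive. *)
Lemma avg_grecip n (w s : R[i]) : n.-primitive_root w -> rnorm s < 1 ->
  (1 - s ^+ n *: T ^+ n) * ((n%:R^-1 : R[i]) *: \sum_(j < n) g (s * w ^+ j)) = 1.
Proof.
move=> wP s1; have n0 := prim_order_gt0 wP.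
rewrite -bop_scaleAr mulr_sumr.
have zj (j : 'I_n) : rnorm (s * w ^+ j) < 1.
  by rewrite rnormM rnormX (prim_root_rnorm wP) expr1n mulr1.
have zn (j : 'I_n) : (s * w ^+ j) ^+ n = s ^+ n.
  by rewrite exprMn -exprM mulnC exprM (prim_expr_order wP) expr1n mulr1.
under eq_bigr => j _ do rewrite -(zn j) onem_expr_grecip//.
rewrite exchange_big /=.
have E (k : 'I_n) : \sum_(j < n) (s * w ^+ j) ^+ k *: T ^+ k =
    if k == 0%N :> nat then n%:R *: (1 : bop X) else 0.
  rewrite -scaler_suml; under eq_bigr do rewrite exprMn.
  rewrite -mulr_sumr (sum_prim_root _ wP); case: ifPn => nk.
    have k0 : (k : nat) = 0%N by apply/eqP; move: nk; apply: contraLR;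
      rewrite -lt0n => k0; rewrite gtnNdvd.
    by rewrite k0 eqxx !expr0 mul1r.
  by rewrite mulr0 scale0r; case: eqP nk => // ->; rewrite dvdn0.
rewrite (eq_bigr _ (fun k _ => E k)); case: n n0 {wP zj zn E} => // n _.
rewrite big_ord_recl/= big1 ?addr0// scalerA mulVf ?scale1r// pnatr_eq0//.
Qed.

Let decays (s : R) := forall e : R, 0 < e ->
  exists N, forall n, (N <= n)%N -> s ^+ n * opnorm (T ^+ n) <= e.

(* Rickart's step: the means are Lipschitz in [s] uniformly in N, so being
   close to 1 at [s] they stay invertible with bounded inverse at [t]. *)
Lemma decays_step (rho G s t u : R) : 0 <= s -> rho < 1 ->
  (forall z, rnorm z <= rho -> opnorm (g z) <= G) ->
  s <= t -> t <= rho -> (t - s) * (opnorm T * G ^+ 2) <= 4^-1 ->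
  0 <= u < t -> decays s -> decays u.
Proof.
move=> s0 rho1 gG st trho tsL /andP[u0 ut] ds.
have t0 : 0 < t := le_lt_trans u0 ut.
(* For x = ||E s - 1||, x <= (x + 1)/5 gives x <= 1/4; the Lipschitz term adds another 1/4, so ||E t
   - 1|| <= 1/2. *)
have [|N HN] := ds 5^-1; first by rewrite invr_gt0.
have bnd n : (N < n)%N -> t ^+ n * opnorm (T ^+ n) <= 3.
  move=> Nn; have [w wP] := @prim_root_exists R n (leq_ltn_trans (leq0n _) Nn).
  have w1 (j : 'I_n) : rnorm (w ^+ j) = 1
    by rewrite rnormX (prim_root_rnorm wP) expr1n.
  have rC (r : R) : 0 <= r -> rnorm (r%:C : R[i]) = r := @rnorm_real R r.
  pose E (r : R) := (n%:R^-1 : R[i]) *: \sum_(j < n) g (r%:C * w ^+ j).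
  have DE (r : R) : 0 <= r -> r < 1 -> (1 - r%:C ^+ n *: T ^+ n) * E r = 1.
    by move=> r0 r1; apply: avg_grecip; rewrite ?rC.
  have nTn (r : R) : 0 <= r ->
    opnorm (r%:C ^+ n *: T ^+ n) = r ^+ n * opnorm (T ^+ n).
    by move=> r0; rewrite opnormZ rnormX rC.
  have srho := le_trans st trho.
  have Es : opnorm (E s - 1) <= 4^-1.
    have : opnorm (E s - 1) <= 5^-1 * (opnorm (E s - 1) + 1).
      have SE : E s - 1 = (s%:C ^+ n *: T ^+ n) * E s.
        by rewrite -[in LHS](DE s s0 (le_lt_trans srho rho1)) mulrBl mul1r subKr.
      rewrite [in leLHS]SE; apply: opnormM_le; first by rewrite nTn// HN// ltnW.
      rewrite -[E s in leLHS](subrK 1) (le_trans (opnormD _ _))//.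
      by rewrite lerD2l opnorm1_le.
    by lra.
  have Et : opnorm (E t - E s) <= 4^-1.
    rewrite /E -scalerBr -sumrB opnorm_avg_le ?invr_ge0// => j.
    have tj : rnorm (t%:C * w ^+ j) = t by rewrite rnormM w1 mulr1 rC// ltW.
    have sj : rnorm (s%:C * w ^+ j) = s by rewrite rnormM w1 mulr1 rC.
    rewrite (grecipB gP) ?tj ?sj ?(le_lt_trans _ rho1)// -mulrBl -rmorphB/=.
    rewrite opnormZ rnormM w1 mulr1 rC ?subr_ge0// (le_trans _ tsL)//.
    rewrite ler_wpM2l ?subr_ge0//.
    rewrite expr2 mulrA [opnorm T * G]mulrC; apply: opnormM_le;
      last by rewrite gG ?tj.
    by apply: opnormM_le; rewrite ?gG ?sj.
  have Et1 : opnorm (E t - 1) <= 2^-1.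
    have := opnormD (E t - E s) (E s - 1); rewrite addrA subrK; lra.
  (* From D = 1 - D (E t - 1) follows ||D|| <= 1 + ||D||/2. *)
  have D2 : opnorm (1 - t%:C ^+ n *: T ^+ n) <= 2.
    set D := 1 - _; have Dt : D * E t = 1 by rewrite DE// ?ltW// (le_lt_trans trho).
    have : opnorm D <= 1 + opnorm D * 2^-1.
      have {1}-> : D = 1 - D * (E t - 1) by rewrite mulrBr mulr1 Dt opprB addrC subrK.
      by rewrite (le_trans (opnormB _ _))// lerD ?opnorm1_le// opnormM_le.
    by lra.
  rewrite -nTn; last exact: ltW.
  set D := _ *: _ in D2 *.
  have := opnormB 1 (1 - D); rewrite subKr; have := @opnorm1_le R X. lra.
(* Boundedness at t becomes decay at u < t through the factor (u/t)^n. *)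
move=> e e0; have [||M HM] := @expr_small R (u / t) (e / 3).
- by rewrite divr_ge0 ?(ltW t0)//= ltr_pdivrMr// mul1r.
- by rewrite divr_gt0.
exists (maxn N.+1 M) => n; rewrite geq_max => /andP[Nn Mn].
have -> : u = u / t * t by rewrite mulfVK ?gt_eqF.
rewrite exprMn -mulrA -[e](divfK (_ : 3 != 0 :> R))// ?pnatr_eq0//.
by rewrite ler_pM ?HM ?bnd ?exprn_ge0 ?divr_ge0 ?mulr_ge0 ?opnorm_ge0 ?exprn_ge0
  ?(ltW t0).
Qed.

(** [decays_step] is iterated from radius 0, where decay is trivial, up to rho; the bound on the
    larger disc of radius sigma makes the increment eta uniform. *)
Lemma opnormX_decay (rho e : R) : 0 <= rho < 1 -> 0 < e ->
  exists N, forall n, (N <= n)%N -> rho ^+ n * opnorm (T ^+ n) <= e.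
Proof.
move=> /andP[r0 r1]; move: e; rewrite -/(decays rho).
pose sigma := (1 + rho) / 2.
have rs : rho < sigma by rewrite /sigma; lra.
have s1 : sigma < 1 by rewrite /sigma; lra.
have [G G1 gG] := grecip_bounded gP s1.
pose L := opnorm T * G ^+ 2.
have L0 : 0 <= L by rewrite mulr_ge0 ?opnorm_ge0 ?exprn_ge0// (le_trans ler01).
(* Each step passes from s to t = u + eta, at most 2 eta above s; this choice keeps t <= sigma and 2
   eta L <= 1/4. *)
pose eta := Num.min (sigma - rho) (8 * (L + 1))^-1.
have eta0 : 0 < eta.
  by rewrite lt_min subr_gt0 rs/= invr_gt0 mulr_gt0// ltr_wpDl.
have etaL : eta * L <= 8^-1.
  apply: (@le_trans _ _ ((8 * (L + 1))^-1 * L)).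
    by rewrite ler_wpM2r// ge_min lexx orbT.
  by rewrite invfM -mulrA ler_piMr// mulrC ler_pdivrMr ?mul1r ?lerDl// ltr_wpDl.
have main k : decays (Num.min rho (k%:R * eta)).
  elim: k => [|k IH].
    rewrite mul0r min_r// => e e0; exists 1%N => -[//|n] _.
    by rewrite exprS !mul0r ltW.
  set s := Num.min rho (k%:R * eta) in IH.
  set u := Num.min rho (k.+1%:R * eta).
  have s0 : 0 <= s by rewrite le_min r0 mulr_ge0// ltW.
  have u0 : 0 <= u by rewrite le_min r0 mulr_ge0// ltW.
  have su : s <= u.
    by rewrite le_min !ge_min lexx/= ler_pM2r// ler_nat leqnSn orbT.
  have us : u <= s + eta.
    rewrite /s /u; case: (leP rho (k%:R * eta)) => H; rewrite ge_min.
      by rewrite lerDl ltW.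
    by rewrite -nat1r mulrDl mul1r addrC lexx orbT.
  have ur : u <= rho by rewrite ge_min lexx.
  have es : eta <= sigma - rho by rewrite ge_min lexx.
  apply: (@decays_step sigma G s (u + eta) u) => //.
  - by rewrite (le_trans su)// lerDl ltW.
  - lra.
  - rewrite (@le_trans _ _ ((eta + eta) * L))//; last by rewrite mulrDl; lra.
    by rewrite ler_wpM2r//; lra.
  - by rewrite u0 ltrDl.
have [k Hk] : exists k : nat, rho <= k%:R * eta.
  exists (Num.trunc (rho / eta)).+1; rewrite -ler_pdivrMr//.
  by apply/ltW; rewrite truncnS_gt.
by have := main k; rewrite min_l.
Qed.

End PowerDecay.

(** * Negative binomial coefficients and polynomial growth *)

Section NegativeBinomial.

(** Together with [bin_addn_ge]: C(n+j, j), the n-th coefficient of (1 - y)^-(j+1), has exact order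
    n^j. *)
Lemma bin_addn_le n j : ('C(n + j, j) <= n.+1 ^ j)%N.
Proof.
elim: j => [|j IH]; first by rewrite bin0.
rewrite -(@leq_pmul2l j.+1)// -mul_bin_diag addnS /=.
apply: (@leq_trans ((j.+1 * n.+1) * n.+1 ^ j)); last by rewrite expnS mulnA.
by apply: leq_mul => //; rewrite mulSn mulnS addnA addSn leq_addr.
Qed.

Lemma bin_addn_ge n j : (n.+1 ^ j <= 'C(n + j, j) * j`!)%N.
Proof.
elim: j => [|j IH]; first by rewrite bin0.
rewrite factS mulnA [X in (_ <= X * _)%N]mulnC -mul_bin_diag addnS /= -mulnA expnS.
by rewrite leq_mul// ltnS leq_addr.
Qed.

(** Truncated form of (1 - y)(1 - y)^-(m+2) = (1 - y)^-(m+1); Pascal's rule leaves one boundary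
    term. *)
Lemma onem_mul_negbin (A : pzRingType) (y : A) m K :
  (1 - y) * \sum_(l < K) y ^+ l *+ 'C(l + m.+1, m.+1) =
  \sum_(l < K) y ^+ l *+ 'C(l + m, m) - y ^+ K *+ 'C(K + m, m.+1).
Proof.
elim: K => [|K IH]; first by rewrite !big_ord0 mulr0 bin_small// mulr0n subr0.
rewrite !big_ord_recr /= mulrDr IH mulrBl mul1r mulrnAr -exprS addSn addnS.
rewrite binS mulrnDr [in X in _ + (X - _)]addrC -!addrA; congr (_ + _).
by rewrite addrCA addKr.
Qed.

(** In q^n = sqrt(q)^n sqrt(q)^n, one factor pays for the new n+1 and the other goes to the
    induction hypothesis. *)
Lemma natrX_expr_bounded (R : realType) (q : R) p : 0 <= q < 1 ->
  exists2 C : R, 0 < C & forall n, n.+1%:R ^+ p * q ^+ n <= C.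
Proof.
elim: p q => [|p IH] q /andP[q0 q1].
  by exists 1 => // n; rewrite mul1r exprn_ile1// ltW.
have sq0 := sqrtr_ge0 q.
have sq1 : Num.sqrt q < 1 by rewrite -sqrtr1 ltr_sqrt.
have [|C C0 HC] := IH (Num.sqrt q); first by rewrite sq0.
have [D D0 HD] : exists2 D : R, 0 < D & forall n, n.+1%:R * Num.sqrt q ^+ n <= D.
  have d0 : 0 < 1 - Num.sqrt q by rewrite subr_gt0.
  exists (1 - Num.sqrt q)^-1 => [|n]; first by rewrite invr_gt0.
  rewrite -[leRHS]mul1r ler_pdivlMr// mulrAC.
  (* (n+1) r^n is at most the geometric sum of the r^i, i <= n, hence at most 1/(1 - r). *)
  have : (1 - Num.sqrt q) * \sum_(i < n.+1) Num.sqrt q ^+ i <= 1.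
    by rewrite -opprB mulNr -subrX1 opprB lerBlDr lerDl exprn_ge0.
  apply: le_trans; rewrite -mulrA mulrCA ler_wpM2l ?(ltW d0)// mulr_natl.
  rewrite -[X in _ *+ X]card_ord -sumr_const ler_sum// => i _.
  by rewrite ler_wiXn2l ?(ltW sq1)// -ltnS.
exists (D * C) => [|n]; first exact: mulr_gt0.
rewrite exprS -[q in q ^+ n]sqr_sqrtr// expr2 exprMn mulrACA.
by rewrite ler_pM ?HD ?HC ?mulr_ge0 ?exprn_ge0.
Qed.

End NegativeBinomial.

(** * Means of the Poisson kernel over roots of unity *)

Section Poisson.
Context {R : realType}.

Lemma rnorm_sqr (x : R[i]) : rnorm x ^+ 2 = complex.Re x ^+ 2 + complex.Im x ^+ 2.
Proof. by rewrite /rnorm normc_def/= sqr_sqrtr// addr_ge0 ?sqr_ge0. Qed.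

(* The Poisson kernel (1 - |z|^2) / |1 - z|^2 is 2 Re (1 - z)^-1 - 1. *)
Lemma poisson_Re (z : R[i]) : rnorm z < 1 ->
  (1 - rnorm z ^+ 2) * (rnorm (1 - z) ^+ 2)^-1 = 2 * complex.Re (1 - z)^-1 - 1.
Proof.
move=> z1; have n0 : 1 - z != 0.
  by rewrite subr_eq0; apply: contraTneq z1 => <-; rewrite rnorm1 ltxx.
(* With v = (1 - z)^-1, z v = v - 1 and |v|^2 - |v - 1|^2 = 2 Re v - 1. *)
have zE : z * (1 - z)^-1 = (1 - z)^-1 - 1.
  by field.
rewrite -exprVn -rnormV; set v := (1 - z)^-1 in zE *.
rewrite mulrBl mul1r -exprMn -rnormM zE !rnorm_sqr; case: v {zE} => a b /=; ring.
Qed.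

(** Scalar counterpart of [avg_grecip]: of the finite geometric sum (1 - s^n)/(1 - s w^j), only the
    constant term survives summation over j. *)
Lemma sum_inv_onem n (w s : R[i]) : n.-primitive_root w -> rnorm s < 1 ->
  (1 - s ^+ n) * \sum_(j < n) (1 - s * w ^+ j)^-1 = n%:R.
Proof.
move=> wP s1; rewrite mulr_sumr.
rewrite (eq_bigr (fun j : 'I_n => \sum_(k < n) s ^+ k * (w ^+ j) ^+ k)); last first.
  move=> j _; have n0 : 1 - s * w ^+ j != 0.
    rewrite subr_eq0; apply: contraTneq s1 => E; rewrite -leNgt -[leLHS](@rnorm1 R) E.
    by rewrite rnormM rnormX (prim_root_rnorm wP) expr1n mulr1.
  have -> : s ^+ n = (s * w ^+ j) ^+ n.
    by rewrite exprMn -exprM mulnC exprM (prim_expr_order wP) expr1n mulr1.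
  rewrite -[X in X / _]opprB subrX1 -mulNr opprB mulrAC divff// mul1r.
  by apply: eq_bigr => k _; rewrite exprMn.
rewrite exchange_big /=; under eq_bigr do rewrite -mulr_sumr (sum_prim_root _ wP).
case: n wP => [/prim_order_gt0//|n] _.
rewrite big_ord_recl/= expr0 mul1r big1 ?addr0// => i _.
by rewrite gtnNdvd ?mulr0// /bump add1n ltnS.
Qed.

(** The mean of the Poisson kernel is exactly 2/(1 - s^n) - 1, at most 3 when s^n <= 1/2; moreover 1
    - s <= 1 - s^2. *)
Lemma avg_poisson_le n (w : R[i]) (s : R) : n.-primitive_root w ->
  0 <= s < 1 -> s ^+ n <= 2^-1 ->
  n%:R^-1 * \sum_(j < n) (rnorm (1 - s%:C * w ^+ j) ^+ 2)^-1 <= 3 / (1 - s).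
Proof.
move=> wP /andP[s0 s1] sn; set S := \sum_(j < n) _.
have sC : rnorm (s%:C : R[i]) = s by rewrite rnorm_real.
have zj (j : 'I_n) : rnorm (s%:C * w ^+ j) = s.
  by rewrite rnormM sC rnormX (prim_root_rnorm wP) expr1n mulr1.
have n0 : 0 < n%:R :> R by rewrite ltr0n (prim_order_gt0 wP).
have q0 : 0 < 1 - s ^+ n by lra.
have SE : (1 - s ^+ 2) * S = 2 * (n%:R / (1 - s ^+ n)) - n%:R.
  have E : \sum_(j < n) (1 - s%:C * w ^+ j)^-1 = (n%:R / (1 - s ^+ n))%:C :> R[i].
    have qC : (1 - s ^+ n)%:C = 1 - s%:C ^+ n :> R[i]
      by rewrite rmorphB/= rmorph1 rmorphXn.
    have qC0 : (1 - s ^+ n)%:C != 0 :> R[i]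
      by rewrite -rnorm_eq0 rnorm_real ?(ltW q0)// gt_eqF.
    rewrite rmorphM/= fmorphV rmorph_nat -(@sum_inv_onem n w s%:C)// ?sC//.
    by rewrite -qC mulrAC divff// mul1r.
  have := congr1 (@complex.Re R) E; rewrite /= raddf_sum/= => <-.
  rewrite mulr_sumr mulr_sumr -[X in _ - X%:R]card_ord -sumr_const -sumrB.
  by apply: eq_bigr => j _; rewrite -{1}(zj j) poisson_Re ?zj.
have s2 : 1 - s <= 1 - s ^+ 2 by rewrite lerD2l lerN2 expr2 ler_piMr// ltW.
have S0 : 0 <= S by apply: sumr_ge0 => j _; rewrite invr_ge0 exprn_ge0 ?rnorm_ge0.
rewrite ler_pdivlMr ?subr_gt0// -mulrA ler_pdivrMl//.
apply: (le_trans (_ : _ <= (1 - s ^+ 2) * S)); first by rewrite mulrC ler_wpM2r.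
have : n%:R / (1 - s ^+ n) <= 2 * n%:R.
  by rewrite ler_pdivrMr// mulrAC ler_peMl ?(ltW n0)//; lra.
by rewrite SE; lra.
Qed.

End Poisson.

(** * Power series of g(z)^(m+1) and Cauchy estimates *)

Section PowersOfReciprocalResolvent.
Context {R : realType} {X : normedModType R[i]} {T : bop X} {g : R[i] -> bop X}.
Hypothesis gP : forall z, rnorm z < 1 -> is_inverse (g z) (1 - z *: T).
Implicit Types (z w : R[i]) (B : bop X).

(** Partial sum of the power series of [g z ^+ m.+1]. *)
Let part m K z : bop X := \sum_(l < K) (z *: T) ^+ l *+ 'C(l + m, m).

Lemma opnormMn B n : opnorm (B *+ n) = opnorm B *+ n.
Proof.
have -> : B *+ n = (n%:R : R[i]) *: B by rewrite scaler_nat.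
by rewrite opnormZ -(rmorph_nat (@real_complex R)) rnorm_real ?ler0n// mulr_natl.
Qed.

Lemma opnorm_scaleX z n : opnorm ((z *: T) ^+ n) = rnorm z ^+ n * opnorm (T ^+ n).
Proof. by rewrite bop_exprZn opnormZ rnormX. Qed.

(** Induction on m, multiplying by [g z]. The remainder keeps the factor (zT)^K while [h] grows only
    polynomially in K. *)
Lemma grecipX_expansion z K m (G : R) : rnorm z < 1 -> 1 <= G -> opnorm (g z) <= G ->
  exists2 h : bop X, g z ^+ m.+1 = part m K z + (z *: T) ^+ K * h &
    opnorm h <= (K.+1%:R * G) ^+ m.+1.
Proof.
move=> z1 G1 gG; have G0 : 0 <= G := le_trans ler01 G1.
have K1 : 1 <= K.+1%:R * G :> R by rewrite mulr_ege1// ler1n.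
have gy : GRing.comm (g z) ((z *: T) ^+ K).
  by apply: commrX; apply: bop_scaler_comm; exact: grecip_commT.
elim: m => [|m [h hE hb]].
  exists (g z); last by rewrite expr1 (le_trans gG)// ler_peMl// ler1n.
  have := onem_expr_grecip gP K z1; rewrite -bop_exprZn mulrBl mul1r.
  move/eqP; rewrite subr_eq expr1 => /eqP gE; rewrite {1}gE; congr (_ + _).
  by apply: eq_bigr => l _; rewrite bin0 mulr1n bop_exprZn.
(* The first term stems from the boundary term of [onem_mul_negbin], the second from the previous
   remainder. *)
exists (g z *+ 'C(K + m, m.+1) + g z * h).
  rewrite exprS hE mulrDr mulrA gy -mulrA mulrDr addrA; congr (_ + _).
  have /eqP := @onem_mul_negbin _ (z *: T) m K; rewrite eq_sym subr_eq => /eqP pE.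
  by rewrite {1}/part pE mulrDr mulrA (gP z1).1 mul1r !mulrnAr gy.
set b := (_ * _) ^+ _ in hb.
have -> : (K.+1%:R * G) ^+ m.+2 = K%:R * b * G + G * b by rewrite exprS -/b -nat1r;
  ring.
rewrite (le_trans (opnormD _ _))// lerD//; last exact: opnormM_le.
rewrite opnormMn -[leLHS]mulr_natl ler_pM ?opnorm_ge0//.
apply: (@le_trans _ _ (K%:R * K%:R ^+ m)).
  rewrite -exprS -natrX ler_nat; case: (K) => [|k]; first by rewrite bin_small.
  by rewrite addSnnS bin_addn_le.
rewrite ler_wpM2l// /b exprMn.
apply: (@le_trans _ _ (K.+1%:R ^+ m.+1));
  last by rewrite ler_peMr ?exprn_ge0// exprn_ege1.
apply: (@le_trans _ _ (K.+1%:R ^+ m)); first by rewrite lerXn2r ?nnegrE// ler_nat.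
by rewrite ler_weXn2l// ler1n.
Qed.

Lemma grecipX_tail m (s e : R) : 0 <= s < 1 -> 0 < e ->
  exists K0, forall K, (K0 <= K)%N -> forall z, rnorm z = s ->
    opnorm (g z ^+ m.+1 - part m K z) <= e.
Proof.
move=> /andP[s0 s1] e0; have [G G1 gG] := grecip_bounded gP s1.
(* In s^K = (s/q)^K q^K, the first factor beats ||T^K||, the second the polynomial bound on [h]. *)
pose q := (s + 1) / 2.
have q0 : 0 < q by rewrite /q; lra.
have q1 : q < 1 by rewrite /q; lra.
have sq : s < q by rewrite /q; lra.
have [|C C0 HC] := @natrX_expr_bounded R q m.+1; first by rewrite (ltW q0).
have CG0 : 0 < C * G ^+ m.+1 by rewrite mulr_gt0// exprn_gt0// (lt_le_trans ltr01).
have sq1 : 0 <= s / q < 1.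
  by rewrite divr_ge0 ?(ltW q0)//= ltr_pdivrMr// mul1r.
have [K0 HK] := opnormX_decay gP sq1 (divr_gt0 e0 CG0).
exists K0 => K KK z zs.
have [h -> hb] := @grecipX_expansion z K m G (eq_ind_r (fun x => x < 1) s1 zs) G1
  (gG _ (eq_ind_r (fun x => x <= s) (lexx s) zs)).
rewrite addrAC subrr add0r (le_trans (opnormM _ _))// opnorm_scaleX zs.
have -> : s ^+ K = (s / q) ^+ K * q ^+ K by rewrite -exprMn mulfVK// gt_eqF.
apply: (@le_trans _ _ (((s / q) ^+ K * opnorm (T ^+ K)) * (q ^+ K *
  (K.+1%:R ^+ m.+1 * G ^+ m.+1)))).
  rewrite -(exprMn m.+1)
    [leLHS](_ : _ = ((s / q) ^+ K * opnorm (T ^+ K)) * (q ^+ K * opnorm h)); last by ring.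
  rewrite ler_wpM2l// ?ler_wpM2l ?exprn_ge0 ?(ltW q0)//.
  by rewrite mulr_ge0 ?opnorm_ge0// exprn_ge0//; case/andP: sq1.
have n0 : C * G ^+ m.+1 != 0 by rewrite gt_eqF.
rewrite -[e](divfK n0) ler_pM ?HK//.
- by rewrite mulr_ge0 ?opnorm_ge0// exprn_ge0//; case/andP: sq1.
- by rewrite !mulr_ge0 ?exprn_ge0 ?(ltW q0)// (le_trans ler01).
by rewrite mulrA ler_wpM2r ?exprn_ge0 ?(le_trans ler01)// mulrC.
Qed.

Lemma opnorm_mul_part B m K z : opnorm (B * part m K z) <=
  \sum_(l < K) rnorm z ^+ l * (opnorm (B * T ^+ l) *+ 'C(l + m, m)).
Proof.
rewrite mulr_sumr (le_trans (opnorm_sum _ _ _))//; apply: ler_sum => l _.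
by rewrite mulrnAr bop_exprZn -bop_scaleAr opnormMn opnormZ rnormX mulrnAr.
Qed.

(** Bounded coefficients are summed against the geometric series of |z|; the tail is arbitrarily
    small. *)
Lemma opnorm_mul_grecipX_le B m (C : R) z : rnorm z < 1 ->
  (forall l, opnorm (B * T ^+ l) *+ 'C(l + m, m) <= C) ->
  opnorm (B * g z ^+ m.+1) <= C / (1 - rnorm z).
Proof.
move=> z1 BC; have C0 : 0 <= C.
  by rewrite (le_trans _ (BC 0%N)) ?mulrn_wge0 ?opnorm_ge0.
apply/ler_addgt0Pr => e e0.
have B0 : 0 < opnorm B + 1 by rewrite ltr_wpDl ?opnorm_ge0.
have [|K0 HK] := @grecipX_tail m (rnorm z) _ _ (divr_gt0 e0 B0);
  first by rewrite rnorm_ge0.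
have := HK _ (leqnn K0) z erefl; set D := _ - _ => HD.
rewrite -[g z ^+ _](subrK (part m K0 z)) -/D mulrDr addrC
  (le_trans (opnormD _ _))// lerD//.
  rewrite (le_trans (opnorm_mul_part _ _ _ _))//.
  apply: (@le_trans _ _ (\sum_(l < K0) rnorm z ^+ l * C)).
    by apply: ler_sum => l _; rewrite ler_wpM2l// exprn_ge0 ?rnorm_ge0.
  rewrite -mulr_suml mulrC ler_wpM2l// -[leRHS]mul1r ler_pdivlMr ?subr_gt0// mulrC.
  by rewrite -opprB mulNr -subrX1 opprB lerBlDr lerDl exprn_ge0 ?rnorm_ge0.
apply: (@le_trans _ _ ((opnorm B + 1) * (e / (opnorm B + 1)))).
  by apply: opnormM_le => //; rewrite lerDl.
by rewrite mulrC mulfVK// gt_eqF.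
Qed.

(* Discrete Cauchy formula: [w ^+ j] to the power [N - n] picks the coefficient
   of index [n] among the first [N] ones. *)
Lemma part_coef m N n w (s : R[i]) : N.-primitive_root w -> (n < N)%N ->
  (N%:R^-1 : R[i]) *: \sum_(j < N) (w ^+ j) ^+ (N - n) *: part m N (s * w ^+ j) =
  (s *: T) ^+ n *+ 'C(n + m, m).
Proof.
move=> wP nN; under eq_bigr do rewrite /part scaler_sumr.
rewrite exchange_big /=.
have E (l : 'I_N) : \sum_(j < N) (w ^+ j) ^+ (N - n) *:
    ((s * w ^+ j *: T) ^+ l *+ 'C(l + m, m)) =
    if l == Ordinal nN then N%:R *: ((s *: T) ^+ l *+ 'C(l + m, m)) else 0.
  rewrite (eq_bigr (fun j : 'I_N => (w ^+ j) ^+ (N - n + l) *: ((s *: T) ^+ l *+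
    'C(l + m, m)))); last first.
    by move=> j _; rewrite !bop_exprZn -!scalerMnr !scalerA exprMn exprD;
      congr (_ *: _ *+ _); ring.
  rewrite -scaler_suml (sum_prim_root _ wP).
  suff -> : (N %| N - n + l)%N = (l == Ordinal nN) by case: ifP => // _;
    rewrite scale0r.
  (* As n, l < N, the exponent N - n + l lies strictly between 0 and 2N; it is a multiple of N only
     for l = n. *)
  apply/idP/eqP => [/dvdnP[[|[|k]] kE]|->] /=.
  - by move: kE nN; rewrite mul0n => /eqP;
    rewrite addn_eq0 subn_eq0 leqNgt => /andP[/negP].
  - apply/val_inj => /=; move: kE; rewrite mul1n => kE.
    by apply/eqP; rewrite -(eqn_add2l (N - n)) kE subnK// ltnW.
  - suff : (N - n + l < k.+2 * N)%N by rewrite kE ltnn.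
    apply: (@leq_trans (N + N)); last by rewrite !mulSn addnA leq_addr.
    by rewrite -addnS leq_add ?leq_subr.
  - by rewrite subnK// ltnW.
rewrite (eq_bigr _ (fun l _ => E l)) -big_mkcond big_pred1_eq scalerA mulVf
  ?scale1r//.
by rewrite pnatr_eq0 -lt0n (prim_order_gt0 wP).
Qed.

(** Cauchy estimate: up to the tail, the partial sum in [part_coef] is the full power of g, and the
    mean of |1 - z|^-2 is at most 3/(1 - s). *)
Lemma opnorm_coef_le B m n (s F : R) : 0 < s < 1 -> 0 <= F ->
  (forall z, rnorm z = s -> opnorm (B * g z ^+ m.+1) <= F / rnorm (1 - z) ^+ 2) ->
  s ^+ n * (opnorm (B * T ^+ n) *+ 'C(n + m, m)) <= 3 * F / (1 - s).
Proof.
move=> /andP[s0 s1] F0 BF; have s01 : 0 <= s < 1 by rewrite (ltW s0).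
apply/ler_addgt0Pr => e e0.
have B0 : 0 < opnorm B + 1 by rewrite ltr_wpDl ?opnorm_ge0.
have [K0 HK] := @grecipX_tail m s _ s01 (divr_gt0 e0 B0).
have [N0 HN] := @expr_small R s 2^-1 s01 ltac:(by rewrite invr_gt0).
(* N exceeds n to isolate the coefficient; K0 makes the tail small and N0 gives s^N <= 1/2. *)
pose N := maxn n.+1 (maxn K0 N0).
have nN : (n < N)%N by rewrite leq_max leqnn.
have KN : (K0 <= N)%N by rewrite !leq_max leqnn orbT.
have NN : (N0 <= N)%N by rewrite !leq_max leqnn !orbT.
have [w wP] := @prim_root_exists R N (leq_ltn_trans (leq0n _) nN).
have sC : rnorm (s%:C : R[i]) = s by rewrite rnorm_real ?ltW.
have w1 j : rnorm (w ^+ j) = 1 by rewrite rnormX (prim_root_rnorm wP) expr1n.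
have zj j : rnorm (s%:C * w ^+ j) = s by rewrite rnormM sC w1 mulr1.
have -> : s ^+ n * (opnorm (B * T ^+ n) *+ 'C(n + m, m)) =
    opnorm (B * ((s%:C *: T) ^+ n *+ 'C(n + m, m))).
  by rewrite bop_exprZn mulrnAr opnormMn -bop_scaleAr opnormZ rnormX sC mulrnAr.
rewrite -(part_coef m _ wP nN) -bop_scaleAr mulr_sumr.
pose D z := g z ^+ m.+1 - part m N z.
have -> : \sum_(j < N) B * ((w ^+ j) ^+ (N - n) *: part m N (s%:C * w ^+ j)) =
    \sum_(j < N) (w ^+ j) ^+ (N - n) *: (B * g (s%:C * w ^+ j) ^+ m.+1) -
    \sum_(j < N) (w ^+ j) ^+ (N - n) *: (B * D (s%:C * w ^+ j)).
  rewrite -sumrB; apply: eq_bigr => j _.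
  by rewrite -scalerBr -mulrBr /D subKr bop_scaleAr.
rewrite scalerBr (le_trans (opnormB _ _))// lerD//.
  rewrite (le_trans (opnorm_avg _))//.
  apply: (@le_trans _ _ (F * (N%:R^-1 * \sum_(j < N) (rnorm (1 - s%:C *
    w ^+ j) ^+ 2)^-1))).
    rewrite mulrCA ler_wpM2l ?invr_ge0// mulr_sumr; apply: ler_sum => j _.
    by rewrite opnormZ rnormX w1 expr1n mul1r BF.
  rewrite [3 * F]mulrC -mulrA ler_wpM2l//.
  exact: avg_poisson_le (HN _ NN).
apply: opnorm_avg_le => [|j]; first exact: ltW.
rewrite opnormZ rnormX w1 expr1n mul1r.
apply: (@le_trans _ _ ((opnorm B + 1) * (e / (opnorm B + 1)))).
  by apply: opnormM_le; rewrite ?lerDl// HK.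
by rewrite mulrC mulfVK// gt_eqF.
Qed.

End PowersOfReciprocalResolvent.

(** * Growth of powers from bounds near the unit circle *)

Section PowerGrowth.
Context {R : realType} {X : normedModType R[i]} {T : bop X} {g : R[i] -> bop X}.
Hypothesis gP : forall z, rnorm z < 1 -> is_inverse (g z) (1 - z *: T).

Lemma opnorm_power_le (B : bop X) m b (F : R) : 0 < F ->
  (forall z, 2^-1 < rnorm z < 1 ->
    opnorm (B * g z ^+ m.+1) <= F / (rnorm (1 - z) ^+ 2 * (1 - rnorm z) ^+ b)) ->
  exists2 C : R, 0 < C & forall n, (1 <= n)%N ->
    n%:R ^+ m * opnorm (B * T ^+ n) <= C * n%:R ^+ b.+1.
Proof.
(* m! comes from [bin_addn_ge], e from s^-n, 3 F from the Cauchy estimate and 3^(b+1) from n + 2 <=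
   3n. *)
move=> F0 BF; exists (m`!%:R * (expR 1 * (3 * F * 3 ^+ b.+1))).
  by rewrite !mulr_gt0 ?expR_gt0 ?exprn_gt0// ltr0n fact_gt0.
move=> n n1; pose s : R := n.+1%:R / n.+2%:R.
have n2 : 0 < n.+2%:R :> R by [].
have n20 : n.+2%:R != 0 :> R by rewrite pnatr_eq0.
have sE : 1 - s = n.+2%:R^-1.
  by apply: (mulIf n20); rewrite mulVf// mulrBl mul1r divfK// -natrB// subSnn.
have s0 : 0 < s by rewrite divr_gt0.
have s1 : s < 1 by rewrite -subr_gt0 sE invr_gt0.
have sh : 2^-1 < s.
  rewrite /s ltr_pdivlMr// mulrC ltr_pdivrMr// -natrM ltr_nat mulnC mul2n -addnn.
  by rewrite addSn ltnS -addSnnS addSn !ltnS -[X in (X <= _)%N]add1n leq_add// .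
(* 1/s = 1 + 1/(n+1) <= exp(1/(n+1)), so the weight s^n costs only a constant. *)
have sn : 1 <= s ^+ n * expR 1.
  apply: (@le_trans _ _ (s ^+ n * expR n.+1%:R^-1 ^+ n)).
    rewrite -exprMn exprn_ege1// /s mulrAC ler_pdivlMr// mul1r.
    apply: (@le_trans _ _ (n.+1%:R * (1 + n.+1%:R^-1)));
      last by rewrite ler_wpM2l// expR_ge1Dx.
    by rewrite mulrDr mulr1 divff ?pnatr_eq0// -natr1.
  rewrite ler_wpM2l ?exprn_ge0 ?(ltW s0)// -expRM_natl ler_expR.
  by rewrite ler_pdivrMr// mul1r ler_nat.
have FB z : rnorm z = s -> opnorm (B * g z ^+ m.+1) <=
  F * n.+2%:R ^+ b / rnorm (1 - z) ^+ 2.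
  move=> zs; have := BF z; rewrite zs sh s1 sE => /(_ isT).
  by rewrite exprVn invfM invrK mulrA mulrAC.
have := opnorm_coef_le gP n _ _ FB; rewrite s0 s1 => /(_ isT).
rewrite mulr_ge0 ?exprn_ge0 ?(ltW F0)// => /(_ isT).
rewrite sE invrK -mulrA -mulrA -exprSr mulrA; set D := opnorm _ => H.
have D0 : 0 <= D by exact: opnorm_ge0.
have H1 : n%:R ^+ m * D <= m`!%:R * (D *+ 'C(n + m, m)).
  rewrite -[D *+ _]mulr_natl mulrA -natrM mulnC; apply: ler_wpM2r => //.
  rewrite -natrX ler_nat (leq_trans _ (bin_addn_ge n m))//.
  by case: (m) => [//|k]; rewrite leq_exp2r.
have H2 : D *+ 'C(n + m, m) <= expR 1 * (s ^+ n * (D *+ 'C(n + m, m))).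
  by rewrite mulrA ler_peMl ?mulrn_wge0// mulrC.
apply: (le_trans H1); rewrite -!mulrA ler_wpM2l//; apply: (le_trans H2).
rewrite ler_wpM2l ?expR_ge0//; apply: (le_trans H);
  rewrite -!mulrA ler_wpM2l// ler_wpM2l ?(ltW F0)//.
by rewrite -exprMn lerXn2r ?nnegrE//
  -natrM ler_nat mulSn mulSn mul1n -addn2 leq_add2l (leq_add n1 n1).
Qed.

End PowerGrowth.

(** * The implications between (i), (ii) and (iii) *)

Section Equivalences.
Context {R : realType} {X : normedModType R[i]} {T : bop X}.
Hypothesis spT : spectrum T `<=` @closed_unit_disk R.
Implicit Types (l z : R[i]).

Lemma resolventP l : 1 < rnorm l -> is_inverse (resolvent l T) (l *: (1 : bop X) - T).
Proof.
move=> l1; apply: (@xgetPex _ 0 [set S | is_inverse S (l *: (1 : bop X) - T)]).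
by apply: contrapT => /spT; rewrite /closed_unit_disk /= leNgt l1.
Qed.

(* g z is the inverse of 1 - z T; z^-1 is 0 at z = 0, hence the case split. *)
Let g z : bop X := if z == 0 then 1 else z^-1 *: resolvent z^-1 T.

Let gP z : rnorm z < 1 -> is_inverse (g z) (1 - z *: T).
Proof.
move=> z1; rewrite /g; case: eqVneq => [->|z0].
  by rewrite scale0r subr0; split; rewrite mulr1.
have zV : 1 < rnorm z^-1 by rewrite rnormV invf_gt1//
  lt_neqAle rnorm_ge0 eq_sym rnorm_eq0 z0.
have [RL LR] := resolventP zV.
have E : z^-1 *: (1 - z *: T) = z^-1 *: (1 : bop X) - T.
  by rewrite scalerBr scalerA mulVf// scale1r.
split; first by rewrite -bop_scaleAl bop_scaleAr E.
by rewrite -bop_scaleAr bop_scaleAl E.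
Qed.

Let res_g l : 1 < rnorm l -> resolvent l T = l^-1 *: g l^-1.
Proof.
move=> l1; have l0 : l != 0 by rewrite -rnorm_eq0 gt_eqF// (lt_trans ltr01).
by rewrite /g invr_eq0 (negbTE l0) invrK scalerA mulVf// scale1r.
Qed.

Let annulus_inv l : 1 < rnorm l < 2 -> 2^-1 < rnorm l^-1 < 1.
Proof.
move=> /andP[l1 l2]; have l0 := lt_trans ltr01 l1.
by rewrite rnormV ltf_pV2 ?posrE// l2 invf_lt1.
Qed.

Let annulus_inv' z : 2^-1 < rnorm z < 1 -> 1 < rnorm z^-1 < 2.
Proof.
move=> /andP[z1 z2]; have z0 : 0 < rnorm z by rewrite (lt_trans _ z1)// invr_gt0.
by rewrite rnormV invf_gt1// z2 -[2]invrK ltf_pV2 ?posrE ?invr_gt0.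
Qed.

Let dist_inv l : 1 < rnorm l -> rnorm (1 - l^-1) = rnorm (l - 1) / rnorm l.
Proof.
move=> l1; have l0 : l != 0 by rewrite -rnorm_eq0 gt_eqF// (lt_trans ltr01).
by rewrite -rnormV -rnormM mulrBl divff// mul1r.
Qed.

Let height_inv l : 1 < rnorm l -> 1 - rnorm l^-1 = (rnorm l - 1) / rnorm l.
Proof.
move=> l1; have l0 : rnorm l != 0 by rewrite gt_eqF// (lt_trans ltr01).
by rewrite rnormV mulrBl divff// mul1r.
Qed.

Let dist_gt0 l : 1 < rnorm l -> 0 < rnorm (l - 1).
Proof.
move=> l1; apply: lt_le_trans (ler_rnormB l 1); rewrite rnorm1.
by rewrite subr_gt0.
Qed.

(** Under z = 1/l both sides scale by |l|^(p+q), so the same C serves. *)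
Let g_bound p q (C : R) :
  (forall l, 1 < rnorm l < 2 ->
    opnorm (resolvent l T ^+ (p + q)) <=
      C / (rnorm (l - 1) ^+ p * (rnorm l - 1) ^+ q)) <->
  (forall z, 2^-1 < rnorm z < 1 ->
    opnorm (g z ^+ (p + q)) <= C / (rnorm (1 - z) ^+ p * (1 - rnorm z) ^+ q)).
Proof.
have E l (D : R) : 1 < rnorm l ->
  rnorm l ^+ (p + q) * (D / (rnorm (l - 1) ^+ p * (rnorm l - 1) ^+ q)) =
    D / (rnorm (1 - l^-1) ^+ p * (1 - rnorm l^-1) ^+ q).
  move=> l1; rewrite dist_inv// height_inv// !expr_div_n exprD.
  have : rnorm l ^+ p != 0 by rewrite expf_neq0// gt_eqF// (lt_trans ltr01).
  have : rnorm l ^+ q != 0 by rewrite expf_neq0// gt_eqF// (lt_trans ltr01).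
  have : rnorm (l - 1) ^+ p != 0 by rewrite expf_neq0// gt_eqF// dist_gt0.
  have : (rnorm l - 1) ^+ q != 0 by rewrite expf_neq0// gt_eqF// subr_gt0.
  move: (_ ^+ q) (_ ^+ p) (_ ^+ q) (_ ^+ p) => x1 x2 x3 x4 *; field; by apply/and4P.
have F l : 1 < rnorm l -> opnorm (g l^-1 ^+ (p + q)) = rnorm l ^+ (p + q) *
  opnorm (resolvent l T ^+ (p + q)).
  move=> l1; have l0 : rnorm l ^+ (p + q) != 0
    by rewrite expf_neq0// gt_eqF// (lt_trans ltr01).
  by rewrite res_g// bop_exprZn opnormZ rnormX rnormV exprVn mulVKf.
split=> H => [z zz|l ll].
  have := annulus_inv' zz => ll; have /andP[l1 _] := ll.
  by have := F _ l1; have := E _ C l1; rewrite invrK => <- ->;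
    rewrite ler_wpM2l ?exprn_ge0 ?rnorm_ge0 ?H.
have /andP[l1 _] := ll; have := H _ (annulus_inv ll).
by rewrite F// -E// ler_pM2l// exprn_gt0// (lt_trans ltr01).
Qed.

Let opnorm_resolvent_le (K : R) l : (forall n, opnorm (T ^+ n) <= K) -> 1 < rnorm l ->
  opnorm (resolvent l T) <= K / (rnorm l - 1).
Proof.
move=> TK l1; have l0 := lt_trans ltr01 l1.
have z1 : rnorm l^-1 < 1 by rewrite rnormV invf_lt1.
have : opnorm (g l^-1) <= K / (1 - rnorm l^-1).
  rewrite -[g _]mul1r -[g _]expr1; apply: (opnorm_mul_grecipX_le gP) => // n.
  by rewrite bin0 mulr1n mul1r.
rewrite height_inv// res_g// opnormZ rnormV => H.
by rewrite ler_pdivrMl// (le_trans H)// invf_div mulrCA mulrA.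
Qed.

(** As |l| - 1 <= |l - 1|, the part |l - 1|^b of |l - 1|^m may be replaced by (|l| - 1)^b. *)
Lemma ritt_resolvent_power_bound m (a b : R) : 0 < a -> 0 < b -> a + b = m%:R ->
  ritt T -> resolvent_power_bound T m a b.
Proof.
move=> a0 b0 abm [_ [C [C0 HC]]]; exists (C ^+ m); split=> [|l ll];
  first exact: exprn_gt0.
have /andP[l1 _] := ll; have x0 := dist_gt0 l1.
have y0 : 0 < rnorm l - 1 by rewrite subr_gt0.
have yx : rnorm l - 1 <= rnorm (l - 1) by have := ler_rnormB l 1; rewrite rnorm1.
rewrite (le_trans (opnormX_le m (HC l ll)))//
  expr_div_n ler_wpM2l ?exprn_ge0 ?(ltW C0)//.
rewrite lef_pV2 ?posrE ?exprn_gt0 ?mulr_gt0 ?powR_gt0//.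
rewrite -powR_mulrn ?(ltW x0)// -abm powRD ?(gt_eqF x0) ?implybT//.
by rewrite ler_wpM2l ?powR_ge0// ge0_ler_powR ?nnegrE ?(ltW b0) ?(ltW x0) ?(ltW y0).
Qed.

(* Raising the bound to a large power makes the exponent of |l - 1| at least 2;
   the excess is then moved to the exponent of |l| - 1. *)
Lemma resolvent_power_bound_sqr m (a b : R) : 0 < a -> 0 < b -> a + b = m%:R ->
  resolvent_power_bound T m a b -> exists M (C : R), 0 < C /\
  forall l, 1 < rnorm l < 2 ->
    opnorm (resolvent l T ^+ (2 + M)) <=
      C / (rnorm (l - 1) ^+ 2 * (rnorm l - 1) ^+ M).
Proof.
move=> a0 b0 abm [C [C0 HC]]; pose j := (Num.trunc (2 / a)).+1.
have ja : 2 <= a * j%:R by rewrite mulrC -ler_pdivrMr// ltW// truncnS_gt.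
have jm : (2 <= m * j)%N.
  rewrite -(@ler_nat R) natrM -abm mulrDl (le_trans ja)// lerDl mulr_ge0// ltW//.
exists (m * j - 2)%N, (C ^+ j); split=> [|l ll]; first exact: exprn_gt0.
have /andP[l1 _] := ll; have x0 := dist_gt0 l1.
have y0 : 0 < rnorm l - 1 by rewrite subr_gt0.
have yx : rnorm l - 1 <= rnorm (l - 1) by have := ler_rnormB l 1; rewrite rnorm1.
rewrite subnKC// exprM (le_trans (opnormX_le j (HC l ll)))// expr_div_n.
rewrite ler_wpM2l ?exprn_ge0 ?(ltW C0)//.
rewrite lef_pV2 ?posrE ?exprn_gt0 ?mulr_gt0 ?powR_gt0 ?exprn_gt0//.
rewrite exprMn -![(_ `^ _) ^+ j]powR_mulrn ?powR_ge0// -!powRrM.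
have -> : a * j%:R = 2%:R + (a * j%:R - 2%:R) by rewrite addrC subrK.
rewrite powRD ?(gt_eqF x0) ?implybT// powR_mulrn ?(ltW x0)// -[leRHS]mulrA.
rewrite ler_wpM2l ?exprn_ge0 ?(ltW x0)//.
apply: (@le_trans _ _ ((rnorm l - 1) `^ (a * j%:R - 2%:R) * (rnorm l - 1) `^ (b *
  j%:R))).
  rewrite -powRD ?(gt_eqF y0) ?implybT//.
  have -> : a * j%:R - 2%:R + b * j%:R = (m * j - 2)%:R.
    by rewrite natrB// natrM -abm; ring.
  by rewrite powR_mulrn ?(ltW y0).
rewrite ler_wpM2r ?powR_ge0// ge0_ler_powR ?nnegrE ?subr_ge0 ?(ltW x0) ?(ltW l1)//.
Qed.

Lemma power_bounded_of_le (C : R) : (forall n, (1 <= n)%N -> opnorm (T ^+ n) <= C) ->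
  forall n, opnorm (T ^+ n) <= Num.max 1 C.
Proof.
by move=> TC [|n]; rewrite le_max ?opnorm1_le// TC ?orbT.
Qed.

(** With B = 1, m = M + 1 and b = M, [opnorm_power_le] has n^(M+1) on both sides. *)
Lemma power_bounded_of_sqr M (C : R) : 0 < C ->
  (forall l, 1 < rnorm l < 2 ->
    opnorm (resolvent l T ^+ (2 + M)) <=
      C / (rnorm (l - 1) ^+ 2 * (rnorm l - 1) ^+ M)) ->
  exists K : R, forall n, opnorm (T ^+ n) <= K.
Proof.
move=> C0 /g_bound HC.
have [|K K0 HK] := @opnorm_power_le _ _ _ _ gP 1 M.+1 M C C0.
  by move=> z zz; rewrite mul1r HC.
exists (Num.max 1 K); apply: power_bounded_of_le => n n1.
have := HK n n1; rewrite mul1r mulrC ler_pM2r//.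
by rewrite exprn_gt0// ltr0n.
Qed.

Lemma power_boundedP : power_bounded T <->
  exists K : R, forall n, opnorm (T ^+ n) <= K.
Proof.
split=> [[K HK]|[K HK]]; first by exists K => n; apply: HK; exists n.
by exists K => _ [n _ <-].
Qed.

(* With [h = mu - l], (1 - (h R(mu))^N) is a perturbation of 1 by less than 1/2
   when [mu] lies radially above [l] at a small multiple of the distance to 1:
   the exponent of |mu - 1| being positive, the smallness of [h] wins. *)
Lemma ritt_of_sqr M (F : R) : 0 < F ->
  (forall l, 1 < rnorm l < 2 ->
    opnorm (resolvent l T ^+ (2 + M)) <=
      F / (rnorm (l - 1) ^+ 2 * (rnorm l - 1) ^+ M)) ->
  ritt T.
Proof.
move=> F0 HF; split=> //; have [K TK] := power_bounded_of_sqr F0 HF.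
have K0 : 0 <= K := le_trans (opnorm_ge0 _) (TK 0%N).
(* eps <= 1/5 keeps mu in the annulus with |mu - 1| >= d/2; 8 F eps <= 1 makes (hA)^(2+M) at most
   1/2. *)
pose eps := (5 + 8 * F)^-1; have D0 : 0 < 5 + 8 * F by rewrite addr_gt0// mulr_gt0.
have eps0 : 0 < eps by rewrite invr_gt0.
have eps5 : eps <= 5^-1 by rewrite lef_pV2 ?posrE// lerDl mulr_ge0// ltW.
have Feps : 8 * F * eps <= 1 by rewrite ler_pdivrMr// mul1r lerDr.
pose Q := \sum_(j < 2 + M) K ^+ j.
have Q0 : 0 <= Q by apply: sumr_ge0 => j _; rewrite exprn_ge0.
have KQ0 : 0 <= 2 * K * Q / eps by rewrite divr_ge0 ?(ltW eps0)// !mulr_ge0.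
exists (6 * K + 2 * K * Q / eps + 1); split=> [|l ll].
  by rewrite ltr_wpDl// addr_ge0// mulr_ge0.
have /andP[l1 l2] := ll; have r0 := lt_trans ltr01 l1.
set r := rnorm l in l1 l2 r0; set d := rnorm (l - 1).
have d0 : 0 < d := dist_gt0 l1.
have dr : d <= r + 1 by have := ler_rnormD l (-1); rewrite rnormN rnorm1.
have RK := opnorm_resolvent_le TK.
(* For |l| >= 3/2, power-boundedness alone gives ||R(l)|| <= 2K, while d <= 3. *)
rewrite ler_pdivlMr//; have [r3|r3] := leP (3 / 2) r.
  apply: (@le_trans _ _ (2 * K * 3)); last by move: KQ0; lra.
  apply: ler_pM => //; [exact: opnorm_ge0|exact: ltW| |by lra].
  rewrite (le_trans (RK _ l1))// ler_pdivrMr ?subr_gt0// -/r.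
  by rewrite mulrAC -[leLHS]mul1r ler_wpM2r//; lra.
pose t := eps * d; have t0 : 0 < t by rewrite mulr_gt0.
pose mu : R[i] := l * (1 + t / r)%:C.
have tr0 : 0 <= t / r by rewrite divr_ge0 ?ltW.
have hE : mu - l = l * (t / r)%:C
  by rewrite /mu rmorphD rmorph1 mulrDr mulr1 addrC addKr.
have hN : rnorm (mu - l) = t
  by rewrite hE rnormM rnorm_real// -/r mulrCA divff ?mulr1// gt_eqF.
have muN : rnorm mu = r + t.
  by rewrite rnormM rnorm_real ?addr_ge0// -/r mulrDr mulr1 mulrCA divff ?mulr1//
    gt_eqF.
have td : t <= d / 5 by rewrite /t mulrC ler_pM2l.
have mu1 : 1 < rnorm mu by rewrite muN; lra.
have mu2 : rnorm mu < 2 by rewrite muN; lra.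
have mud : d / 2 <= rnorm (mu - 1).
  have := ler_rnormB (l - 1) (l - mu); rewrite -/d (rnorm_distC l mu) hN.
  have -> : l - 1 - (l - mu) = mu - 1 by ring.
  lra.
set A := resolvent mu T; pose h := mu - l; pose S := \sum_(j < 2 + M) (h *: A) ^+ j.
have AK : opnorm A <= K / t.
  rewrite (le_trans (RK _ mu1))// ler_wpM2l// lef_pV2 ?posrE ?subr_gt0//.
  by rewrite muN; lra.
have hA : opnorm (h *: A) <= K.
  by rewrite opnormZ /h hN mulrC -ler_pdivlMr.
have SQ : opnorm S <= Q.
  by rewrite (le_trans (opnorm_sum _ _ _))//; apply: ler_sum => j _;
    exact: opnormX_le.
have hAN : opnorm ((h *: A) ^+ (2 + M)) <= 2^-1.
  rewrite bop_exprZn opnormZ rnormX hN.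
  apply: (@le_trans _ _ (t ^+ (2 + M) * (F / ((d / 2) ^+ 2 * t ^+ M)))).
    rewrite ler_wpM2l ?exprn_ge0 ?(ltW t0)// (le_trans (HF mu _)) ?mu1//.
    have p0 : 0 < d / 2 by rewrite divr_gt0.
    rewrite ler_wpM2l ?(ltW F0)//
      lef_pV2 ?posrE ?mulr_gt0 ?exprn_gt0 ?subr_gt0 ?(lt_le_trans p0 mud)//.
    have tm : t <= rnorm mu - 1 by rewrite muN; lra.
    by rewrite ler_pM ?exprn_ge0 ?(ltW t0) ?(ltW p0)//
      lerXn2r ?nnegrE ?(ltW t0) ?(ltW p0) ?(le_trans _ mud) ?(le_trans _ tm)
        ?(ltW t0) ?(ltW p0).
  (* Since t = eps d, the distance d cancels and only eps^2 remains. *)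
  have -> : t ^+ (2 + M) * (F / ((d / 2) ^+ 2 * t ^+ M)) = 4 * F * eps ^+ 2.
    rewrite exprD; have tM : t ^+ M != 0 by rewrite expf_neq0// gt_eqF.
    move: (t ^+ M) tM => tM tM0; rewrite /t; field.
    by rewrite tM0 gt_eqF.
  have : 4 * F * eps <= 2^-1 by move: Feps; lra.
  apply: le_trans; rewrite expr2 mulrA ler_piMr ?mulr_ge0 ?(ltW F0) ?(ltW eps0)//.
  by rewrite (le_trans eps5)// invf_le1//; lra.
(* Resolvent identity. Multiplied by the geometric sum S, it gives R(l) (1 - (hA)^(2+M)) = A S,
   whose remainder is absorbed below. *)
have RA : resolvent l T * (1 - h *: A) = A.
  have -> : 1 - h *: A = (l *: (1 : bop X) - T) * A.
    rewrite -[in LHS](resolventP mu1).2 -/A.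
    have -> : l *: (1 : bop X) - T = mu *: (1 : bop X) - T - h *: (1 : bop X).
      by rewrite /h scalerBl opprB [RHS]addrC addrA subrK.
    by rewrite [RHS]mulrBl -bop_scaleAl mul1r.
  by rewrite mulrA (resolventP l1).1 mul1r.
have RS : resolvent l T = A * S + resolvent l T * (h *: A) ^+ (2 + M).
  have : resolvent l T * (1 - (h *: A) ^+ (2 + M)) = A * S.
    rewrite -[X in X * S]RA -mulrA; congr (_ * _).
    by rewrite -opprB subrX1 -mulNr opprB.
  by rewrite mulrBr mulr1 => /eqP; rewrite subr_eq => /eqP.
have : opnorm (resolvent l T) <= K / t * Q + opnorm (resolvent l T) * 2^-1.
  by rewrite {1}RS (le_trans (opnormD _ _))// lerD// opnormM_le.
move=> H; have {H} : opnorm (resolvent l T) <= 2 * (K / t * Q) by lra.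
rewrite -(ler_pM2r d0) => /le_trans; apply.
have -> : 2 * (K / t * Q) * d = 2 * K * Q / eps by rewrite /t; field; rewrite !gt_eqF.
by rewrite -addrA addrCA lerDl addr_ge0// mulr_ge0.
Qed.

(** Splitting z(1 - T) = (1 - zT) + (z - 1) trades 1 - T for the scalar z - 1. *)
Let g_onem z : rnorm z < 1 -> g z * (z *: (1 - T)) = 1 + (z - 1) *: g z.
Proof.
move=> z1; rewrite -[in RHS](gP z1).1 -{3}[g z]mulr1 bop_scaleAr -mulrDr;
  congr (_ * _).
by rewrite scalerBr scalerBl scale1r [RHS]addrC addrA subrK.
Qed.

Let g_commD z : rnorm z < 1 -> GRing.comm (g z) (1 - T).
Proof.
move=> z1; apply: commrB; first exact: commr1.
exact: grecip_commT.
Qed.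

Lemma ritt_power_bounds k : ritt T -> exists2 C : R, 0 < C & forall n, (1 <= n)%N ->
  opnorm (T ^+ n * (1 - T) ^+ k) <= C * n%:R ^- k.
Proof.
move=> [_ [C [C0 HC]]].
have : forall z, 2^-1 < rnorm z < 1 ->
    opnorm (g z ^+ (1 + 0)) <= C / (rnorm (1 - z) ^+ 1 * (1 - rnorm z) ^+ 0).
  by apply/g_bound => l ll; rewrite !expr1 expr0 mulr1 HC.
rewrite addn0 => gC.
have D0 : 0 < (2 * (1 + C)) ^+ k * C ^+ 2.
  by rewrite mulr_gt0 ?exprn_gt0 ?mulr_gt0 ?addr_gt0.
have [|L L0 HL] := @opnorm_power_le _ _ _ _ gP ((1 - T) ^+ k) k.+1 0 _ D0.
  move=> z zz; have /andP[zh z1] := zz.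
  have d0 : 0 < rnorm (1 - z).
    by apply: lt_le_trans (ler_rnormB 1 z); rewrite rnorm1 subr_gt0.
  have := gC z zz; rewrite !expr1 expr0 mulr1 => gz.
  (* The factor 2 pays for dividing by |z| > 1/2. *)
  have gD : opnorm ((1 - T) * g z) <= 2 * (1 + C).
    rewrite -(g_commD z1) -(@ler_pM2l _ (rnorm z)) ?(lt_trans _ zh) ?invr_gt0//.
    rewrite -opnormZ bop_scaleAr g_onem//; apply: (@le_trans _ _ (1 + C)).
      rewrite (le_trans (opnormD _ _))// lerD ?opnorm1_le//.
      by rewrite opnormZ rnorm_distC mulrC -ler_pdivlMr.
    rewrite mulrA ler_peMl ?addr_ge0 ?(ltW C0)//.
    by rewrite -ler_pdivrMr// mul1r ltW.
  (* (1 - T)^k g^(k+2) = ((1 - T) g)^k g^2: bounded factors, and two g for |1 - z|^-2. *)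
  rewrite -(addn2 k) exprD mulrA -exprMn_comm; last exact/commr_sym/g_commD.
  rewrite mulr1 -mulrA -expr_div_n; apply: opnormM_le; exact: opnormX_le.
exists L => // n n1; have n0 : 0 < n%:R :> R by rewrite ltr0n.
have := HL n n1; rewrite expr1 exprSr -mulrA [n%:R * _]mulrC mulrA ler_pM2r//.
rewrite mulrC -ler_pdivlMr ?exprn_gt0//.
suff -> : T ^+ n * (1 - T) ^+ k = (1 - T) ^+ k * T ^+ n by [].
apply: commrX; apply: commr_sym; apply: commrX; apply: commr_sym.
by apply: commrB; first exact: commr1.
Qed.

(** Let x = (z - 1) g and y = 1 + x = z(1 - T) g. The decay hypothesis controls y^(k+1) g, the
    difference y^(k+1) - x^(k+1) factors through y - x = 1, and x^(k+1) g is (z - 1)^(k+1)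
    g^(k+2). *)
Lemma resolvent_power_bound_of_powers (K : R) k :
  (forall n, opnorm (T ^+ n) <= K) ->
  seq_bigO (fun n => opnorm (T ^+ n * (1 - T) ^+ k.+1)) (fun n => n%:R ^- k.+1) ->
  resolvent_power_bound T k.+2 1 k.+1%:R.
Proof.
move=> TK [C [C0 HC]].
(* With K >= 1 and d Y >= 1, the summand 1 of y is absorbed into K d Y. *)
wlog K1 : K TK / 1 <= K.
  move=> H; apply: (H (Num.max 1 K)); last by rewrite le_max lexx.
  by move=> n; rewrite le_max TK orbT.
have K0 : 0 < K := lt_le_trans ltr01 K1.
pose B := (1 - T) ^+ k.+1; pose D := opnorm B + 2 ^+ k.+1 * C.
have D0 : 0 < D by rewrite ltr_wpDl ?opnorm_ge0// mulr_gt0 ?exprn_gt0.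
(* The decay n^-(k+1) offsets the binomial growth; ||B|| covers n = 0. *)
have BD n : opnorm (B * T ^+ n) *+ 'C(n + k.+1, k.+1) <= D.
  case: n => [|n].
    by rewrite binn mulr1n mulr1 lerDl mulr_ge0 ?exprn_ge0 ?(ltW C0).
  have -> : B * T ^+ n.+1 = T ^+ n.+1 * B.
    apply: commrX; apply: commr_sym; apply: commrX.
    by apply: commrB; first exact: commr1.
  rewrite -[leLHS]mulr_natl (le_trans (_ : _ <= 2 ^+ k.+1 * C)) ?lerDr ?opnorm_ge0//.
  have p0 : 0 < n.+1%:R ^+ k.+1 :> R by rewrite exprn_gt0.
  apply: (@le_trans _ _ ((2 * n.+1%:R) ^+ k.+1 * (C / n.+1%:R ^+ k.+1))).
    apply: ler_pM; rewrite ?ler0n ?opnorm_ge0 ?HC//.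
    rewrite -natrM -natrX ler_nat (leq_trans (bin_addn_le _ _))// leq_exp2r//.
    by rewrite mul2n -addnn addSn !ltnS leq_addl.
  by rewrite exprMn -mulrA [C / _]mulrC mulVKf// gt_eqF.
pose E := (D + k.+1%:R * (2 * K) ^+ k * K).
have E0 : 0 < E by rewrite ltr_wpDr// !mulr_ge0 ?exprn_ge0 ?mulr_ge0 ?(ltW K0).
have gE : forall z, 2^-1 < rnorm z < 1 ->
    opnorm (g z ^+ (1 + k.+1)) <= E / (rnorm (1 - z) ^+ 1 * (1 - rnorm z) ^+ k.+1).
  move=> z /andP[zh z1]; have y0 : 0 < 1 - rnorm z by rewrite subr_gt0.
  set d := rnorm (1 - z); set Y := (1 - rnorm z)^-1.
  have Y0 : 0 < Y by rewrite invr_gt0.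
  have yd : 1 - rnorm z <= d by have := ler_rnormB 1 z; rewrite rnorm1.
  have d0 : 0 < d := lt_le_trans y0 yd.
  have dY : 1 <= d * Y by rewrite ler_pdivlMr// mul1r.
  have gK : opnorm (g z) <= K * Y.
    rewrite -[g z]mul1r -[g z]expr1; apply: (opnorm_mul_grecipX_le gP) => // n.
    by rewrite bin0 mulr1n mul1r.
  have BgD : opnorm (B * g z ^+ k.+2) <= D * Y by exact: (opnorm_mul_grecipX_le gP).
  pose x := (z - 1) *: g z; pose y := 1 + x.
  have xV : opnorm x <= 2 * K * (d * Y).
    rewrite opnormZ rnorm_distC -/d mulrC (le_trans (ler_wpM2r (ltW d0) gK))//.
    rewrite (_ : _ * _ * d = K * (d * Y)); last by ring.
    by rewrite -mulrA ler_peMl ?mulr_ge0 ?(ltW K0) ?(ltW d0) ?(ltW Y0)// ler1n.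
  have yV : opnorm y <= 2 * K * (d * Y).
    rewrite (le_trans (opnormD _ _))//.
    have : opnorm x <= K * (d * Y).
      by rewrite opnormZ rnorm_distC -/d mulrC (le_trans (ler_wpM2r (ltW d0) gK))//
        mulrAC -mulrA mulrCA mulrA.
    have : 1 <= K * (d * Y) by rewrite mulr_ege1.
    by have := @opnorm1_le R X; lra.
  have yE : y ^+ k.+1 * g z = z ^+ k.+1 *: (B * g z ^+ k.+2).
    rewrite /y -g_onem// exprMn_comm; last exact/bop_scaler_comm/g_commD.
    have gB : GRing.comm (g z ^+ k.+1) B by apply: commrX; apply: commr_sym;
      apply: commrX; exact/commr_sym/g_commD.
    by rewrite bop_exprZn -bop_scaleAr gB -bop_scaleAl -mulrA -exprSr.
  have xy : GRing.comm y x by apply: commr_sym; apply: commrD; first exact: commr1.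
  have : x ^+ k.+1 * g z = y ^+ k.+1 * g z - (\sum_(i < k.+1) y ^+ (k - i) *
    x ^+ i) * g z.
    have := subrXX_comm k.+1 xy; rewrite /y addrK mul1r => <-.
    by rewrite -mulrBl subKr.
  move=> /(congr1 (@opnorm _ _));
    rewrite {1}/x bop_exprZn -bop_scaleAl -exprSr opnormZ rnormX rnorm_distC -/d =>
      xg.
  (* Division by d^(k+1) turns (d Y)^k Y into Y^(k+1)/d. *)
  have : d ^+ k.+1 * opnorm (g z ^+ k.+2) <= E * ((d * Y) ^+ k * Y).
    rewrite xg mulrDl (le_trans (opnormB _ _))// lerD//.
      rewrite yE opnormZ rnormX; apply: (@le_trans _ _ (1 * (D * Y))).
        by rewrite ler_pM ?exprn_ge0 ?rnorm_ge0 ?opnorm_ge0//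
          exprn_ile1 ?rnorm_ge0// ltW.
      by rewrite mul1r ler_wpM2l ?(ltW D0)// ler_peMl ?(ltW Y0)// exprn_ege1.
    rewrite [leRHS](_ : _ = (k.+1%:R * (2 * K * (d * Y)) ^+ k) * (K * Y));
      last by rewrite (exprMn k (2 * K) (d * Y)); ring.
    apply: opnormM_le => //; rewrite (le_trans (opnorm_sum _ _ _))// mulr_natl.
    rewrite -[X in _ *+ X]card_ord -sumr_const; apply: ler_sum => i _.
    have -> : (2 * K * (d * Y)) ^+ k = (2 * K * (d * Y)) ^+ (k - i) * (2 * K * (d *
      Y)) ^+ i.
      by rewrite -exprD subnK// -ltnS.
    by apply: opnormM_le; apply: opnormX_le.
  rewrite -ler_pdivlMl ?exprn_gt0// => /le_trans; apply; rewrite le_eqVlt;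
    apply/orP; left.
  have -> : 1 - rnorm z = Y^-1 by rewrite invrK.
  apply/eqP; rewrite exprVn exprMn expr1 !exprS.
  have dk : d ^+ k != 0 by rewrite expf_neq0// gt_eqF.
  have Yk : Y ^+ k != 0 by rewrite expf_neq0// gt_eqF.
  by move: (d ^+ k) (Y ^+ k) dk Yk => dk Yk dk0 Yk0; field; rewrite dk0 Yk0 !gt_eqF.
have HR := (g_bound 1 k.+1 E).2 gE.
exists E; split=> // l ll; have /andP[l1 _] := ll.
rewrite powRr1 ?rnorm_ge0// powR_mulrn ?subr_ge0 ?(ltW l1)//.
by have := HR l ll; rewrite expr1.
Qed.

End Equivalences.

(** * Assembly of the equivalences *)

Theorem theorem7p1 (R : realType) (X : completeNormedModType R[i]) (T : bop X)
  (spT : spectrum T `<=` @closed_unit_disk R)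
  (spT1 : spectrum T `&` @unit_circle R `<=` [set 1]) :
  [/\ ritt T <->
        (exists (m : nat) (a b : R),
           [/\ (1 <= m)%N, 0 < a, 0 < b, a + b = m%:R &
               resolvent_power_bound T m a b]),
      ritt T <->
        (forall (m : nat) (a b : R),
           (1 <= m)%N -> 0 < a -> 0 < b -> a + b = m%:R ->
           resolvent_power_bound T m a b),
      ritt T <->
        (power_bounded T /\
         exists k : nat, (1 <= k)%N /\
           seq_bigO (fun n => opnorm (T ^+ n * (1 - T) ^+ k))
                    (fun n => n%:R ^- k)) &
      ritt T <->
        (power_bounded T /\
         forall k : nat, (1 <= k)%N ->
           seq_bigO (fun n => opnorm (T ^+ n * (1 - T) ^+ k))
                    (fun n => n%:R ^- k))].
Proof.
have rpbP : ritt T -> power_bounded T.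
  (* The case k = 0 is power-boundedness. *)
  move=> rT; have [C _ HC] := ritt_power_bounds spT 0 rT.
  apply/power_boundedP; exists (Num.max 1 C); apply: power_bounded_of_le => n n1.
  by have := HC n n1; rewrite !expr0 mulr1 invr1 mulr1.
have i_iii k : ritt T -> seq_bigO (fun n => opnorm (T ^+ n *
  (1 - T) ^+ k)) (fun n => n%:R ^- k).
  by move=> rT; have [C C0 HC] := ritt_power_bounds spT k rT; exists C.
have ii_i m a b : 0 < a -> 0 < b -> a + b = m%:R ->
  resolvent_power_bound T m a b -> ritt T.
  move=> a0 b0 abm /(resolvent_power_bound_sqr a0 b0 abm)[M [C [C0 HC]]].
  exact: ritt_of_sqr spT _ _ C0 HC.
have iii_i k : (1 <= k)%N -> power_bounded T ->
    seq_bigO (fun n => opnorm (T ^+ n * (1 - T) ^+ k)) (fun n => n%:R ^- k) -> ritt T.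
  case: k => // k _ /power_boundedP[K TK] /(resolvent_power_bound_of_powers spT TK).
  by apply: ii_i => //; rewrite -nat1r.
split; split.
(* m = 1 with a = b = 1/2 is the witness here and the instance taken from the universal form
   below. *)
- move=> rT; exists 1%N, 2^-1, 2^-1.
  by split; [..|apply: ritt_resolvent_power_bound]; rewrite ?invr_gt0//; lra.
- by move=> [m [a [b [_ a0 b0 abm]]]]; exact: ii_i.
- by move=> rT m a b _ a0 b0 abm; exact: ritt_resolvent_power_bound.
- move=> H; have h0 : 0 < 2^-1 :> R by rewrite invr_gt0.
  have h1 : 2^-1 + 2^-1 = 1%:R :> R by lra.
  exact: (ii_i _ _ _ h0 h0 h1 (H 1%N _ _ isT h0 h0 h1)).
- by move=> rT; split; [exact: rpbP|exists 1%N; split => //; exact: i_iii].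
- by move=> [pT [k [k1 Hk]]]; exact: iii_i Hk.
- by move=> rT; split; [exact: rpbP|move=> k _; exact: i_iii].
- by move=> [pT H]; apply: (iii_i 1%N) => //; exact: H.
Qed.
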